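(* Let $p\ge1$ and $k\in\{0,\dots,\lfloor p\rfloor\}$. (a) The lift map $\mathbb 1^{(\cdot)}:\mathfrak I^{(k,p)}(V)\to\mathscr H^{(k,p)}(V)$ is a bijection whose inverse is $\operatorname{dev}$. (b) For every control $\omega$ on $J$ and every exponent $\phi\in(1-\frac1p,1]$, the restricted maps $$\mathbb 1^{(\cdot)}:\mathfrak I^{(k,p)}_{\phi,\omega}(V)\to\mathscr H^{(k,p)}_{\phi,\omega}(V),\qquad \mathbb 1^{(\cdot)}:\mathfrak I^{(k,p)}_{\phi}(V)\to\mathscr H^{(k,p)}_{\phi}(V),\qquad \mathbb 1^{(\cdot)}:\mathfrak I^{(k,p)}_{\omega}(V)\to\mathscr H^{(k,p)}_{\omega}(V)$$ are each bijective, with inverse given by the corresponding restriction of $\operatorname{dev}$.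
   Context: Setting. $J=[S,T]$ is a fixed compact interval and $\triangle_J=\{(s,t)\in J^2: s\le t\}$. $V$ is a Banach space; $V^{\otimes n}$ ($V^{\otimes 0}=\mathbb R$) denotes its completed tensor powers with admissible norms: permutations in $S_n$ act by isometries on $V^{\otimes n}$, and $\|v\otimes w\|\le\|v\|\|w\|$. $T^{(k)}(V)=\bigoplus_{i=0}^kV^{\otimes i}$ with product $(a\otimes b)^i=\sum_{j=0}^i a^j\otimes b^{i-j}$; $a^i$ is the level-$i$ component. A control on $J$ is a continuous $\omega:\triangle_J\to[0,\infty)$ with $\omega(t,t)=0$ and $\omega(s,u)+\omega(u,t)\le\omega(s,t)$ for $s\le u\le t$. Put $x!:=\Gamma(x+1)$, $\beta(p)=p\bigl(1+\sum_{r=3}^\infty(\frac{2}{r-2})^{(\lfloor p\rfloor+1)/p}\bigr)$. A map $X:\triangle_J\to T^{(k)}(V)$ has finite $p$-variation controlled by $\omega$ with constant $K$ if $\|X^i_{s,t}\|\le K\,\omega(s,t)^{i/p}/(\beta(p)(i/p)!)$ for $i=1,\dots,k$, $(s,t)\in\triangle_J$. A multiplicative functional of degree $k$ is a continuous $X:\triangle_J\to T^{(k)}(V)$ with $X^0\equiv1$ and $X_{s,u}\otimes X_{u,t}=X_{s,t}$ for $s\le u\le t$. $\Omega^{(k,p)}_\omega(V)$: those of finite $p$-variation controlled by $\omega$ with some constant; $\Omega^{(k,p)}(V)$: union over all controls. $\mathscr H$-spaces. For $k\ge1$, $\phi\in(1-\frac1p,1]$ and a control $\omega$, $\mathscr H^{(k,p)}_{\phi,\omega}(V)$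 is the set of $H\in\Omega^{(k,p)}_\omega(V)$ such that for some $K_H\ge0$, $\|H^j_{s,t}\|\le K_H\omega(s,t)^\phi$ for all $j=1,\dots,k$, $(s,t)\in\triangle_J$. $\mathscr H^{(k,p)}_\phi$, $\mathscr H^{(k,p)}_\omega$, $\mathscr H^{(k,p)}$ denote the unions over $\omega$, over $\phi\in(1-\frac1p,1]$, and over both. For $k=0$ all these spaces are $\{(1)\}$. $\mathfrak I$-spaces. For $k\in\{1,\dots,\lfloor p\rfloor\}$, $\mathfrak I^{(k,p)}_{\phi,\omega}(V)$ is the set of maps $I=(0,I^1,\dots,I^k):\triangle_J\to T^{(k)}(V)$ that are additive ($I_{s,u}+I_{u,t}=I_{s,t}$ for $s\le u\le t$) and for which there is $K\ge0$ with $\|I^j_{s,t}\|\le K\omega(s,t)^\phi$ for $j=1,\dots,k$, $(s,t)\in\triangle_J$, and in addition, if $k=\lfloor p\rfloor$, $\|I^k_{s,t}\|\le K\omega(s,t)^{k/p}$. $\mathfrak I^{(k,p)}_\phi$, $\mathfrak I^{(k,p)}_\omega$, $\mathfrak I^{(k,p)}$ are the unions over $\omega$, over $\phi\in(1-\frac1p,1]$, over both. For $k=0$ all are $\{(0)\}$. Extension map. If $Z$ is a multiplicative functional of degree $j$ with finite $q$-variation for some $q\in[1,j+1)$, $\operatorname{Ext}_j(Z)$ is the unique multiplicative functional of degree $j+1$ that agrees with $Z$ in levels $\le j$ and has finite $q$-variation (Lyons' extension theorem; independent of such $q$). For $H\in\mathscr H^{(k,p)}_\phi(V)$ and $1\le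 j\le k-1$, $(1,H^1,\dots,H^j)$ has finite $(j/\phi)$-variation with $j/\phi<j+1$, so $\operatorname{Ext}_j$ applies. Development map. $\operatorname{dev}(H):=(0,H^1,H^2-E^2,\dots,H^k-E^k)$ with $E^{j+1}:=\bigl(\operatorname{Ext}_j(1,H^1,\dots,H^j)\bigr)^{j+1}$, $1\le j\le k-1$ (for $k=0$: $\operatorname{dev}((1))=(0)$). Lift map. For $I=(0,I^1,\dots,I^k)\in\mathfrak I^{(k,p)}(V)$ define recursively $\mathbb 1^{(0,I^1)}:=(1,I^1)$ and, for $2\le m\le k$, $\mathbb 1^{(0,I^1,\dots,I^m)}:=\operatorname{Ext}_{m-1}\bigl(\mathbb 1^{(0,I^1,\dots,I^{m-1})}\bigr)+(0,\dots,0,I^m)$ (for $k=0$: $\mathbb 1^{(0)}=(1)$). *)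

(* Defs.v *)
From HB Require Import structures.
From mathcomp Require Import all_boot all_order all_algebra perm.
From mathcomp Require Import all_classical all_reals all_analysis.

Set Implicit Arguments.
Unset Strict Implicit.
Unset Printing Implicit Defensive.

Import Order.TTheory GRing.Theory Num.Theory numFieldNormedType.Exports.

Local Open Scope classical_set_scope.
Local Open Scope ring_scope.

(* [tpow A n] is V^{(x)n}; [tscal] and [tvec] are the identifications
   R = V^{(x)0} and V = V^{(x)1}; [tmul] is the tensor multiplication. *)
Record tensor_data (R : realType) (V : completeNormedModType R) := TensorData {
  tpow : nat -> completeNormedModType R ;
  tscal : {linear R^o -> tpow 0} ;
  tvec : {linear V -> tpow 1} ;
  tmul : forall m n : nat, tpow m -> tpow n -> tpow (m + n) }.

Section TensorPowers.
Context {R : realType} {V : completeNormedModType R} (A : tensor_data V).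

Definition tpow_cast m n (e : m = n) (x : tpow A m) : tpow A n :=
  ecast i (tpow A i) e x.

Fixpoint pure n : ('I_n -> V) -> tpow A n :=
  if n is m.+1 then
    fun v => tmul (tvec A (v ord0)) (pure (fun i => v (lift ord0 i)))
  else fun=> tscal A 1.

(* the algebraic tensor power, as a subspace of its completion *)
Definition pure_span n : set (tpow A n) :=
  [set x | exists s : seq (R * ('I_n -> V)),
      x = \sum_(c <- s) c.1 *: pure c.2].

Definition multilinear n (W : lmodType R) (f : ('I_n -> V) -> W) : Prop :=
  forall (v : 'I_n -> V) (i : 'I_n) (a : R) (x y : V),
    f [eta v with i |-> a *: x + y] =
    a *: f [eta v with i |-> x] + f [eta v with i |-> y].

(* The first group of fields makes A a graded algebra; [pure_universal] says
   that the span of the elementary tensors is the algebraic n-th tensor power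
   of V (the factorization is automatically unique on the span), and
   [pure_dense] that V^{(x)n}, which is complete, is its completion.  The
   remaining fields are the admissibility of the norms. *)
Record admissible_tensor_powers : Prop := AdmissibleTensorPowers {
  tscal_norm : forall a : R, `|tscal A a| = `|a| ;
  tscal_surj : forall x : tpow A 0, exists a : R, x = tscal A a ;
  tvec_norm : forall v : V, `|tvec A v| = `|v| ;
  tvec_surj : forall x : tpow A 1, exists v : V, x = tvec A v ;
  tmul_linear_r : forall m n (x : tpow A m),
    linear (fun y : tpow A n => tmul x y) ;
  tmul_linear_l : forall m n (y : tpow A n),
    linear (fun x : tpow A m => tmul x y) ;
  tmul_scal_l : forall n (a : R) (x : tpow A n),
    tmul (tscal A a) x = a *: x :> tpow A n ;
  tmul_scal_r : forall n (a : R) (x : tpow A n),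
    tpow_cast (addn0 n) (tmul x (tscal A a)) = a *: x ;
  tmulA : forall m n q (x : tpow A m) (y : tpow A n) (z : tpow A q),
    tpow_cast (addnA m n q) (tmul x (tmul y z)) = tmul (tmul x y) z ;
  pure_universal : forall n (W : lmodType R) (f : ('I_n -> V) -> W),
    multilinear f ->
    exists g : tpow A n -> W,
      (forall (a : R) (x y : tpow A n), pure_span x -> pure_span y ->
         g (a *: x + y) = a *: g x + g y) /\
      (forall v : 'I_n -> V, g (pure v) = f v) ;
  pure_dense : forall n, dense (@pure_span n) ;
  tmul_norm : forall m n (x : tpow A m) (y : tpow A n),
    `|tmul x y| <= `|x| * `|y| ;
  perm_isometry : forall n (s : 'S_n),
    exists P : {linear tpow A n -> tpow A n},
      (forall x, `|P x| = `|x|) /\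
      (forall v : 'I_n -> V, P (pure v) = pure (v \o s)) }.

(* T^(k)(V) is represented by the families (a^i)_{i : nat} that vanish in
   levels i > k. *)
Definition tseq := forall i : nat, tpow A i.

Definition truncated (k : nat) (a : tseq) : Prop :=
  forall i, (k < i)%N -> a i = 0.

Definition tone : tseq := fun i => if i is 0%N then tscal A 1 else 0.

Definition tprod (k : nat) (a b : tseq) : tseq := fun i =>
  if (i <= k)%N then
    \sum_(j < i.+1) tpow_cast (subnKC (leq_ord j)) (tmul (a j) (b (i - j)%N))
  else 0.

Definition ttrunc (k : nat) (a : tseq) : tseq :=
  fun i => if (i <= k)%N then a i else 0.

End TensorPowers.

Definition simplex {R : realType} (S T : R) : set (R * R) :=
  [set st | [/\ S <= st.1, st.1 <= st.2 & st.2 <= T]].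

Section Simplex.
Context {R : realType} {S T : R}.

(* x = (s, u), y = (u, t) and z = (s, t) for some s <= u <= t *)
Definition chained (x y z : simplex S T) : Prop :=
  [/\ (val z).1 = (val x).1, (val x).2 = (val y).1 & (val y).2 = (val z).2].

Definition control : set (simplex S T -> R) :=
  [set w : simplex S T -> R | [/\ continuous w,
    (forall x, 0 <= w x),
    (forall x, (val x).1 = (val x).2 -> w x = 0) &
    (forall x y z, chained x y z -> w x + w y <= w z)]].

End Simplex.

Section Constants.
Context {R : realType}.

Definition Gamma (x : R) : R :=
  \int[@lebesgue_measure R]_(t in `]0, +oo[) (t `^ (x - 1) * expR (- t)).

Definition gfact (x : R) : R := Gamma (x + 1).

Definition beta_cst (p : R) : R :=
  p * (1 + limn (fun n => \sum_(3 <= r < n)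
             (2 / (r%:R - 2)) `^ ((Num.truncn p).+1%:R / p) : R)).

Definition exponents (p : R) : set R := `]1 - p^-1, 1].

End Constants.

Section Spaces.
Context {R : realType} {V : completeNormedModType R} (A : tensor_data V).
Variables S T : R.

Definition tmap := simplex S T -> tseq A.

(* The topology of T^(k)(V) is that of a finite direct sum, so continuity is
   continuity of every level. *)
Definition multiplicative_functional (k : nat) : set tmap :=
  [set X | [/\ forall x, truncated k (X x),
    forall i, continuous (fun x => X x i),
    forall x, X x 0%N = tscal A 1 &
    forall x y z, chained x y z -> tprod k (X x) (X y) = X z]].

Definition finite_variation (k : nat) (p : R) (w : simplex S T -> R) (K : R)
    (X : tmap) : Prop :=
  forall x i, (1 <= i <= k)%N ->
    `|X x i| <= K * (w x `^ (i%:R / p) / (beta_cst p * gfact (i%:R / p))).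

Definition Omega_w (k : nat) (p : R) (w : simplex S T -> R) : set tmap :=
  [set X | multiplicative_functional k X /\
           exists K : R, finite_variation k p w K X].

Definition Omega (k : nat) (p : R) : set tmap :=
  \bigcup_(w in control) Omega_w k p w.

(* For k = 0 the condition on the levels is void and the space is {(1)}. *)
Definition H_phi_w (k : nat) (p phi : R) (w : simplex S T -> R) : set tmap :=
  [set H | Omega_w k p w H /\
    exists2 K : R, 0 <= K &
      forall x j, (1 <= j <= k)%N -> `|H x j| <= K * w x `^ phi].

Definition H_phi (k : nat) (p phi : R) : set tmap :=
  \bigcup_(w in control) H_phi_w k p phi w.

Definition H_w (k : nat) (p : R) (w : simplex S T -> R) : set tmap :=
  \bigcup_(phi in exponents p) H_phi_w k p phi w.

Definition H_all (k : nat) (p : R) : set tmap :=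
  \bigcup_(phi in exponents p) \bigcup_(w in control) H_phi_w k p phi w.

(* For k = 0 (and p >= 1) the estimates are void and the space is {(0)}. *)
Definition I_phi_w (k : nat) (p phi : R) (w : simplex S T -> R) : set tmap :=
  [set I | [/\ forall x, truncated k (I x),
    forall x, I x 0%N = 0,
    forall x y z, chained x y z -> forall i, I x i + I y i = I z i &
    exists2 K : R, 0 <= K & forall x,
      (forall j, (1 <= j <= k)%N -> `|I x j| <= K * w x `^ phi) /\
      (k = Num.truncn p -> `|I x k| <= K * w x `^ (k%:R / p))]].

Definition I_phi (k : nat) (p phi : R) : set tmap :=
  \bigcup_(w in control) I_phi_w k p phi w.

Definition I_w (k : nat) (p : R) (w : simplex S T -> R) : set tmap :=
  \bigcup_(phi in exponents p) I_phi_w k p phi w.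

Definition I_all (k : nat) (p : R) : set tmap :=
  \bigcup_(phi in exponents p) \bigcup_(w in control) I_phi_w k p phi w.

Definition is_extension (j : nat) (Z Y : tmap) : Prop :=
  [/\ multiplicative_functional j.+1 Y,
    forall x i, (i <= j)%N -> Y x i = Z x i &
    exists q : R, [/\ 1 <= q, q < j.+1%:R, Omega j q Z & Omega j.+1 q Y]].

(* The extension of Z whenever it exists, the junk value Z otherwise. *)
Definition Ext (j : nat) (Z : tmap) : tmap := xget Z (is_extension j Z).

(* (1, H^1, ..., H^j) is the truncation of H, since H^0 = 1. *)
Definition dev (k : nat) (H : tmap) : tmap := fun x i =>
  if (i <= k)%N then
    match i with
    | 0 => 0
    | 1 => H x 1%N
    | j.+2 => H x j.+2 - Ext j.+1 (fun y => ttrunc j.+1 (H y)) x j.+2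
    end
  else 0.

Definition only_level (m : nat) (I : tmap) : tmap :=
  fun x i => if i == m then I x i else 0.

(* Only the levels 1, ..., k of I are used. *)
Fixpoint lift_map (k : nat) (I : tmap) : tmap :=
  match k with
  | 0 => fun=> tone A
  | 1 => fun x i => tone A i + only_level 1 I x i
  | m.+1 => fun x i => Ext m (lift_map m I) x i + only_level m.+1 I x i
  end.

End Spaces.

Definition bij_with_inverse (E F : Type) (B : set E) (C : set F)
    (f : E -> F) (g : F -> E) : Prop :=
  [/\ set_bij B C f, set_fun C B g,
      {in B, cancel f g} & {in C, cancel g f}].

(* Main.v *)
Require Import Defs.
From HB Require Import structures.
From mathcomp Require Import all_boot all_order all_algebra perm.
From mathcomp Require Import all_classical all_reals all_analysis.
From mathcomp Require Import measurable_realfun ring lra zify.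

(** Everything rests on Lyons' extension theorem, which is proved here in the form
that the lift and development maps use.  Write n = j + 1.  If Z is multiplicative
of degree j, an extra level y makes it multiplicative of degree n exactly when
y_{s,t} - y_{s,u} - y_{u,t} equals the sum of the mixed products
Z^i_{s,u} Z^{n-i}_{u,t}, 0 < i < n (lemmas [mf_top] and [mf_extend]).  Two
consequences follow.

Two admissible top levels over the same Z differ by an additive map, and adding an
additive map to an admissible top level gives another one.  An additive map bounded
by a power greater than one of a control vanishes ([additive_small_eq0]), so the
extension of finite q-variation is unique when q < n ([extension_unique]).

A top level exists: freezing the left end point at S gives the germ
g(s,t) = sum of Z^i_{S,s} Z^{n-i}_{s,t}, whose defect from additivity is, by
associativity of the tensor product, minus the sum of mixed products
([cross_cocycle]), hence O(w^{n/q}) with n/q > 1.  The sewing lemma ([sewing])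
gives an additive G with G - g = O(w^{n/q}), and y := G - g is the wanted level,
with the wanted bound ([extension_exists]).

For H with |H^i| <= K w^phi, i <= j, the extension is taken with q = j / phi.  Since
phi > 1 - 1/p and n <= p, one has q < n, and the new level is bounded by
w^{n phi / j}; the exponent is at least phi and at least n / p, because
phi > j / p ([ext_or_one_spec]).  The canonical extension therefore satisfies every
estimate of the spaces at once, for the same control and the same phi, and the
estimates for H^n and for H^n - E^n are equivalent, level by level.  Adding and
subtracting E^n are then mutually inverse for each fixed phi and w
([lift_map_fun], [dev_fun], [dev_lift_map], [lift_map_dev]), and the other three
bijections follow by taking unions.

The constants beta(p) and (i/p)! are positive, so finite p-variation means that level
i is O(w^{i/p}) ([finite_variationP]); these are the bounds used throughout. *)

Set Implicit Arguments.
Unset Strict Implicit.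
Unset Printing Implicit Defensive.

Import Order.TTheory GRing.Theory Num.Theory numFieldNormedType.Exports.

Local Open Scope classical_set_scope.
Local Open Scope ring_scope.

(** * Positivity of the normalising constants *)

(** t^x <= 1 + t^N for an integer N >= x, and (t/2)^N / N! is a term of the
exponential series of t/2. *)
Lemma expR_dominates_powR (R : realType) (x : R) : 0 <= x ->
  exists2 M : R, 0 <= M & forall t, 0 < t -> t `^ x <= M * expR (t / 2).
Proof.
move=> x0; set N := (Num.truncn x).+1.
have xN : x <= N%:R by apply: ltW; exact: truncnS_gt.
have M0 : 0 <= (2 ^+ N * N`!%:R : R) by rewrite mulr_ge0 ?exprn_ge0.
exists (1 + 2 ^+ N * N`!%:R); first by rewrite addr_ge0.
move=> t t0; have th0 : 0 <= t / 2 by rewrite divr_ge0 ?ltW.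
have e1 : 1 <= expR (t / 2) by apply: le_trans (expR_ge1Dx _); rewrite lerDl.
rewrite mulrDl mul1r; have [t1|t1] := leP t 1.
  apply: (@le_trans _ _ 1); last by rewrite -[leLHS]addr0 lerD ?mulr_ge0 ?expR_ge0.
  by have := ge0_ler_powR x0 _ _ t1; rewrite powR1; apply; rewrite nnegrE ?ltW.
apply: (@le_trans _ _ (t `^ N%:R)); first by rewrite ler_powR ?(ltW t1).
rewrite powR_mulrn ?(ltW t0)//.
apply: (@le_trans _ _ (2 ^+ N * N`!%:R * expR (t / 2))); last first.
  by rewrite lerDr expR_ge0.
have /= := expR_ge1Dxn (Num.truncn x) th0; rewrite -/N => h.
have {}h : (t / 2) ^+ N / N`!%:R <= expR (t / 2) by apply: le_trans h; rewrite lerDr.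
have -> : t ^+ N = 2 ^+ N * N`!%:R * ((t / 2) ^+ N / N`!%:R).
  rewrite expr_div_n; field.
  by rewrite pnatr_eq0 -lt0n fact_gt0 expf_neq0 ?pnatr_eq0.
by rewrite ler_wpM2l.
Qed.

(** The real-valued integral is zero by convention when it diverges, so positivity
needs integrability: the integrand is dominated by a multiple of exp(-t/2). *)
Lemma gfact_gt0 (R : realType) (x : R) : 0 <= x -> 0 < gfact x.
Proof.
move=> x0; rewrite /gfact /Gamma addrK.
set f := fun t : R => t `^ x * expR (- t).
have f0 t : 0 <= f t by rewrite mulr_ge0 ?powR_ge0 ?expR_ge0.
have mf D : measurable_fun D f.
  apply: (measurable_funS measurableT) => //; apply: measurable_funM.
    exact: measurable_powR.
  apply: measurableT_comp; first exact: measurable_expR.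
  exact: oppr_measurable.
have If : lebesgue_measure.-integrable `]0, +oo[ (EFin \o f).
  have [M M0 HM] := expR_dominates_powR x0.
  have h2 : (0 : R) < 2^-1 by rewrite invr_gt0.
  have Ig : lebesgue_measure.-integrable `]0, +oo[
      (fun t => ((2 * M)%:E * (exponential_pdf (2^-1 : R) t)%:E)%E).
    apply: integrableZl; first exact: measurable_itv.
    apply: (integrableS measurableT); [exact: measurable_itv|by []|].
    exact: integrable_exponential_pdf.
  apply: le_integrable Ig; first exact: measurable_itv.
  - by apply/measurable_EFinP; exact: mf.
  - move=> t; rewrite /= in_itv/= andbT => t0.
    rewrite lee_fin ger0_norm// ger0_norm ?mulr_ge0 ?exponential_pdf_ge0 ?(ltW h2)//.
    rewrite exponential_pdfE ?(ltW t0)//.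
    have -> : - 2^-1 * t = t / 2 - t by lra.
    rewrite expRD (_ : 2 * M * _ = M * expR (t / 2) * expR (- t)); last by field.
    by rewrite ler_wpM2r ?expR_ge0 ?HM.
rewrite /Rintegral fine_gt0//; apply/andP; split; last first.
  by apply: integrable_lty => //; exact: measurable_itv.
pose D := `[1, 2]%classic : set R.
have mD : lebesgue_measure D = 1%:E.
  by rewrite /D lebesgue_measure_itv/= lte_fin ltr1n -EFinD; congr EFin; lra.
have h12 : (0 < \int[lebesgue_measure]_(t in D) (expR (- 2) : R)%:E)%E.
  rewrite integral_cst; last exact: measurable_itv.
  by rewrite [X in (_ * X)%E](_ : _ = 1%:E) ?mule1 ?lte_fin ?expR_gt0//; exact: mD.
apply: (lt_le_trans h12).
apply: (@le_trans _ _ (\int[lebesgue_measure]_(t in D) (f t)%:E)%E).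
  apply: ge0_le_integral => //.
  - exact: measurable_itv.
  - by apply/measurable_EFinP; exact: mf.
  - move=> t; rewrite /D /= in_itv/= => /andP[t1 t2]; rewrite lee_fin /f.
    rewrite -[leLHS]mul1r ler_pM ?expR_ge0//; last by rewrite ler_expR lerN2.
    by rewrite -[leLHS](powRr0 t) ler_powR.
apply: ge0_subset_integral => //.
- exact: measurable_itv.
- by apply/measurable_EFinP; exact: mf.
- by move=> t _; rewrite lee_fin f0.
- by move=> t; rewrite /D /= !in_itv/= => /andP[t1 t2]; rewrite andbT; lra.
Qed.

(** The factor of p is at least 1: the partial sums are nonnegative, and so is their
limit, which is zero by convention for a divergent sequence. *)
Lemma beta_cst_gt0 (R : realType) (p : R) : 0 < p -> 0 < beta_cst p.
Proof.
move=> p0; rewrite /beta_cst mulr_gt0// ltr_pwDl//.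
set u := (fun n => _).
have [cu|ncu] := pselect (cvgn u); last by rewrite dvgP.
apply: limr_ge => //; near=> n; rewrite /u; apply: sumr_ge0 => *; exact: powR_ge0.
Unshelve. all: by end_near. Qed.

(** * Sewing along a superadditive function *)

Lemma powR_small (R : realType) (a K d : R) : 0 < a -> 0 <= K -> 0 < d ->
  exists2 e : R, 0 < e & K * e `^ a <= d.
Proof.
move=> a0 K0 d0; have K1 : 0 < K + 1 by rewrite ltr_wpDl.
exists ((d / (K + 1)) `^ a^-1); first by rewrite powR_gt0// divr_gt0.
rewrite -powRrM mulVf ?gt_eqF// powRr1; last by rewrite divr_ge0 ?ltW.
rewrite mulrCA ler_piMr ?(ltW d0)// ler_pdivrMr// mul1r; lra.
Qed.

Lemma powR_split (R : realType) (x a : R) : 0 <= x -> 1 < a ->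
  x `^ a = x `^ (a - 1) * x.
Proof.
move=> x0 a1; rewrite -[X in _ * X]powRr1// -powRD ?subrK//.
by rewrite (gt_eqF (lt_trans ltr01 a1)).
Qed.

Lemma path_le_last (R : realType) (s : R) (l : seq R) :
  path <=%R s l -> forall x, x \in s :: l -> x <= last s l.
Proof.
elim: l s => [|u l IH] s /=; first by move=> _ x; rewrite inE => /eqP ->.
case/andP=> su pl x; rewrite inE => /predU1P[->|]; last exact: IH.
by apply: le_trans su _; apply: IH => //; rewrite mem_head.
Qed.

Lemma subseq_cons_split (X : eqType) (u : X) (l L : seq X) :
  subseq (u :: l) L -> exists P Q, L = P ++ u :: Q /\ subseq l Q.
Proof.
elim: L => [//|y L IH] /=; case: eqP => [-> ?|_ /IH[P [Q [-> ?]]]].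
  by exists [::], L.
by exists (y :: P), Q.
Qed.

Fixpoint rsum (R : realType) (E : zmodType) (g : R -> R -> E) (s : R)
    (l : seq R) : E :=
  if l is u :: l' then g s u + rsum g u l' else 0.

Lemma rsum_cat (R : realType) (E : zmodType) (g : R -> R -> E) s l l' :
  rsum g s (l ++ l') = rsum g s l + rsum g (last s l) l'.
Proof.
by elim: l s => [|u l IH] s /=; rewrite ?add0r// IH addrA.
Qed.

Section Sewing.
Context {R : realType} (S T : R) (W : R -> R -> R).

(** A control is used below only through superadditivity and the possibility of
splitting an interval into two parts of at most half the size. *)
Record halvable_control : Prop := HalvableControl {
  hc_ge0 : forall s t, S <= s -> s <= t -> t <= T -> 0 <= W s t ;
  hc_super : forall s u t, S <= s -> s <= u -> u <= t -> t <= T ->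
    W s u + W u t <= W s t ;
  hc_half : forall s t, S <= s -> s <= t -> t <= T -> exists u,
    [/\ s <= u, u <= t, W s u <= W s t / 2 & W u t <= W s t / 2] }.

Hypothesis HW : halvable_control.

Lemma hc_diag s : S <= s -> s <= T -> W s s = 0.
Proof.
move=> Ss sT; have := hc_super HW Ss (lexx s) (lexx s) sT.
have := hc_ge0 HW Ss (lexx s) sT; lra.
Qed.

(** Repeated halving: after n steps every cell has size at most W s t / 2 ^ n. *)
Lemma hc_partition e s t : 0 < e -> S <= s -> s <= t -> t <= T ->
  exists l, [/\ path <=%R s l, last s l = t & path (fun x y => W x y <= e) s l].
Proof.
move=> e0 Ss st tT.
have [n Hn] : exists n, W s t <= e * 2 ^+ n.
  exists (Num.truncn (W s t / e)).+1.
  rewrite mulrC -ler_pdivrMr//; apply: le_trans (ltW (truncnS_gt _)) _.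
  by rewrite -natrX ler_nat ltnW// ltn_expl.
elim: n s t Ss st tT Hn => [|n IH] s t Ss st tT Hn.
  by exists [:: t]; split=> //=; rewrite ?st// andbT; rewrite mulr1 in Hn.
have [u [su ut W1 W2]] := hc_half HW Ss st tT.
have Hn2 : W s t / 2 <= e * 2 ^+ n by move: Hn; rewrite exprS; lra.
have [l1 [p1 e1 m1]] := IH _ _ Ss su (le_trans ut tT) (le_trans W1 Hn2).
have [l2 [p2 e2 m2]] := IH _ _ (le_trans Ss su) ut tT (le_trans W2 Hn2).
exists (l1 ++ l2); split; first by rewrite cat_path p1 e1.
  by rewrite last_cat e1.
by rewrite cat_path m1 e1.
Qed.

Section Target.
Context {E : completeNormedModType R}.
Implicit Types (g D : R -> R -> E).

Variables (th C : R).
Hypothesis th1 : 1 < th.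
Hypothesis C0 : 0 <= C.

Let th0 : 0 < th. Proof. exact: lt_trans ltr01 th1. Qed.

(** Summing over a partition with cells of size at most e gives
|D s t| <= C e^(th-1) W s t by superadditivity, and e is arbitrary. *)
Lemma additive_small_eq0 D :
  (forall s u t, S <= s -> s <= u -> u <= t -> t <= T -> D s t = D s u + D u t) ->
  (forall s t, S <= s -> s <= t -> t <= T -> `|D s t| <= C * W s t `^ th) ->
  forall s t, S <= s -> s <= t -> t <= T -> D s t = 0.
Proof.
move=> Dadd Dle s t Ss st tT.
have Wst := hc_ge0 HW Ss st tT.
have main e : 0 < e -> `|D s t| <= C * W s t * e `^ (th - 1).
  move=> e0; have [l [pl el ml]] := hc_partition e0 Ss st tT.
  move: tT Wst; rewrite -el {t st el}; elim: l s Ss pl ml => [|u l IH] s Ss /=.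
    move=> _ _ sT _; have := Dadd s s s Ss (lexx s) (lexx s) sT.
    move/eqP; rewrite -subr_eq0 opprD addrA subrr sub0r oppr_eq0 => /eqP ->.
    by rewrite normr0 !mulr_ge0 ?powR_ge0// (hc_ge0 HW).
  case/andP=> su pl /andP[Wsu ml] tT Wst.
  have ut : u <= last u l by apply: path_le_last pl _ _; rewrite mem_head.
  have Su := le_trans Ss su; have uT := le_trans ut tT.
  have Wut := hc_ge0 HW Su ut tT; have Wsu0 := hc_ge0 HW Ss su uT.
  rewrite (Dadd s u)//; apply: le_trans (ler_normD _ _) _.
  apply: le_trans (lerD (Dle _ _ Ss su uT) (IH _ Su pl ml tT Wut)) _.
  apply: (@le_trans _ _ (C * (W s u + W u (last u l)) * e `^ (th - 1))); last first.
    by rewrite ler_wpM2r ?powR_ge0// ler_wpM2l// (hc_super HW).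
  rewrite mulrDr mulrDl lerD2r -mulrA ler_wpM2l// powR_split// mulrC.
  by rewrite ler_wpM2l// ge0_ler_powR ?nnegrE ?subr_ge0 ?(ltW th1)// ?(ltW e0).
apply/eqP; rewrite -normr_le0; apply/ler_addgt0Pr => d d0; rewrite add0r.
have [||e e0 He] := @powR_small _ (th - 1) (C * W s t) d _ _ d0.
- by rewrite subr_gt0.
- by rewrite mulr_ge0.
- exact: le_trans (main e e0) He.
Qed.

Variable g : R -> R -> E.
Hypothesis gD : forall s u t, S <= s -> s <= u -> u <= t -> t <= T ->
  `|g s t - g s u - g u t| <= C * W s t `^ th.

Let ratio : R := 2 `^ (1 - th).
Let C' : R := 2 * C / (1 - ratio).

Let ratio1 : ratio < 1.
Proof.
rewrite /ratio -[ltRHS](powRr0 2) /powR pnatr_eq0/= ltr_expR mul0r.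
by rewrite nmulr_rlt0 ?ln_gt0 ?ltr1n// subr_lt0.
Qed.

Let C'0 : 0 <= C'. Proof. by rewrite divr_ge0 ?mulr_ge0// subr_ge0 ltW. Qed.

Lemma germ_diag s : S <= s -> s <= T -> g s s = 0.
Proof.
move=> Ss sT; have := gD Ss (lexx s) (lexx s) sT.
rewrite hc_diag// powR0 ?gt_eqF// mulr0 subrr sub0r normrN normr_le0.
by move/eqP.
Qed.

(** A maximal inequality, uniform in the partition.  Cut the partition at the first
point u with W s u at least half of W s t: the two pieces on either side of the cell
ending at u have size at most W s t / 2, so they contribute a factor
2 * 2^(-th) = ratio < 1 of the bound, and reinserting the cell costs two defects of
the germ.  The constant C' is the fixed point of c = c * ratio + 2 * C. *)
Lemma rsum_close s l : S <= s -> path <=%R s l -> last s l <= T ->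
  `|rsum g s l - g s (last s l)| <= C' * W s (last s l) `^ th.
Proof.
have [n] := ubnP (size l); elim: n s l => // n IH s l.
case: (eqVneq l [::]) => [-> _ Ss _ /= sT|l0 ln Ss pl tT].
  by rewrite germ_diag// subrr normr0 mulr_ge0 ?powR_ge0.
set t := last s l in tT *.
have st : s <= t by apply: path_le_last pl _ _; rewrite mem_head.
have Wst := hc_ge0 HW Ss st tT.
(* t itself qualifies, so a first point u past the half of W s t exists. *)
pose a x := W s t / 2 <= W s x.
have ha : has a l.
  apply/hasP; exists t; last by rewrite /a; lra.
  by move: l0; rewrite /t; case: (l) => // u l' _; rewrite /= mem_last.
have [P [u [Q [lE au aP]]]] : exists P u Q, [/\ l = P ++ u :: Q, a u & ~~ has a P].
  case: (split_find ha) => x s1 s2 ax hs1.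
  by exists s1, x, s2; rewrite cat_rcons.
set x := last s P.
have [pP xu pQ] : [/\ path <=%R s P, x <= u & path <=%R u Q].
  by move: pl; rewrite lE cat_path /= => /and3P[].
have tE : t = last u Q by rewrite /t lE last_cat.
have sx : s <= x by apply: path_le_last pP _ _; rewrite mem_head.
have ut : u <= t by rewrite tE; apply: path_le_last pQ _ _; rewrite mem_head.
have uT := le_trans ut tT; have xT := le_trans xu uT.
have su := le_trans sx xu; have Su := le_trans Ss su.
have Sx := le_trans Ss sx.
have Wsx : W s x <= W s t / 2.
  rewrite /x; case: (lastP P) aP => [_|P' y].
    by rewrite /= hc_diag ?divr_ge0// (le_trans st).
  by rewrite last_rcons has_rcons negb_or /a -ltNge => /andP[/ltW].
have Wut : W u t <= W s t / 2.
  by have := hc_super HW Ss su ut tT; move: au; rewrite /a; lra.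
have [sP sQ] : (size P < n)%N /\ (size Q < n)%N.
  move: ln; rewrite lE size_cat /= addnS !ltnS => h.
  by split; apply: leq_trans h; rewrite ltnS ?leq_addr ?leq_addl.
have hP := IH _ _ sP Ss pP xT.
have hQ : `|rsum g u Q - g u t| <= C' * W u t `^ th.
  by rewrite tE; apply: IH => //; rewrite -tE.
(* The gain ratio < 1 comes from halving, as th > 1. *)
have half y : 0 <= y -> y <= W s t / 2 -> 2 * y `^ th <= ratio * W s t `^ th.
  move=> y0 yW; apply: (@le_trans _ _ (2 * (W s t / 2) `^ th)).
    by rewrite ler_wpM2l// ge0_ler_powR ?nnegrE ?(ltW th0) ?divr_ge0.
  rewrite powRM// ?invr_ge0// -powR_inv1// -powRrM mulrCA mulrA [X in _ <= X]mulrC.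
  rewrite -mulrA ler_wpM2l ?powR_ge0//.
  rewrite /ratio powRD ?pnatr_eq0 ?implybT// powRr1// mulN1r //.
have g1 := gD Ss su ut tT; have g2 := gD Ss sx xu uT.
have Wmono : C * W s u `^ th <= C * W s t `^ th.
  rewrite ler_wpM2l// ge0_ler_powR ?nnegrE ?(ltW th0)// ?(hc_ge0 HW)//.
  by have := hc_super HW Ss su ut tT; have := hc_ge0 HW Su ut tT; lra.
have -> : rsum g s l - g s t =
    (rsum g s P - g s x) + (rsum g u Q - g u t) -
    (g s u - g s x - g x u) - (g s t - g s u - g u t).
  rewrite lE rsum_cat /= -/x.
  rewrite !opprB !addrA. rewrite [RHS](ACl (1*5*3*10*(2*6)*(4*8)*(7*9)))%AC/=.
  by rewrite ?(subrr, addNr, addr0).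
have hx := half _ (hc_ge0 HW Ss sx xT) Wsx.
have hu := half _ (hc_ge0 HW Su ut tT) Wut.
have key : C' * ratio + 2 * C = C'.
  rewrite /C'; field.
  by have := ratio1; lra.
apply: le_trans (ler_normB _ _) _; apply: le_trans (lerD (ler_normB _ _) (lexx _)) _.
apply: le_trans (lerD (lerD (ler_normD _ _) (lexx _)) (lexx _)) _.
have hx' := ler_wpM2l C'0 hx; have hu' := ler_wpM2l C'0 hu.
have key' : C' * (ratio * W s t `^ th) + 2 * (C * W s t `^ th) = C' * W s t `^ th.
  by rewrite -[in RHS]key; ring.
by rewrite -/x in hP; lra.
Qed.


(** [rsum_close] applied in each cell of the coarser partition. *)
Lemma rsum_refine e s l L : 0 < e -> S <= s -> subseq l L ->
  path <=%R s L -> last s L = last s l -> last s l <= T ->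
  path (fun x y => W x y <= e) s l ->
  `|rsum g s L - rsum g s l| <= C' * e `^ (th - 1) * W s (last s l).
Proof.
move=> e0; elim: l s L => [|u l IH] s L Ss /=.
  move=> _ pL eL sT _; have := rsum_close Ss pL; rewrite eL => /(_ sT).
  by rewrite germ_diag// hc_diag// powR0 ?(gt_eqF th0)// !mulr0.
move=> /subseq_cons_split[P [Q [-> lQ]]]; rewrite cat_path last_cat /=.
case/and3P=> pP xu pQ eQ tT /andP[Wsu ml].
set x := last s P in xu *; set t := last u l in eQ tT *.
have sx : s <= x by apply: path_le_last pP _ _; rewrite mem_head.
have ut : u <= t by rewrite -eQ; apply: path_le_last pQ _ _; rewrite mem_head.
have su := le_trans sx xu; have Su := le_trans Ss su; have uT := le_trans ut tT.
have hQ := IH _ _ Su lQ pQ eQ tT ml.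
have hP : `|rsum g s (rcons P u) - g s u| <= C' * e `^ (th - 1) * W s u.
  have := @rsum_close s (rcons P u) Ss; rewrite last_rcons rcons_path pP xu.
  move=> /(_ isT uT) /le_trans; apply; rewrite -mulrA ler_wpM2l//.
  have W0 := hc_ge0 HW Ss su uT.
  rewrite powR_split// ler_wpM2r// ge0_ler_powR ?nnegrE ?subr_ge0 ?(ltW th1)//.
  exact: ltW.
rewrite -cat_rcons rsum_cat last_rcons.
have -> : rsum g s (rcons P u) + rsum g u Q - (g s u + rsum g u l) =
    (rsum g s (rcons P u) - g s u) + (rsum g u Q - rsum g u l).
  by rewrite opprD addrACA.
apply: le_trans (ler_normD _ _) _; apply: le_trans (lerD hP hQ) _.
by rewrite -mulrDr ler_wpM2l ?(hc_super HW)// mulr_ge0 ?powR_ge0.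
Qed.

(** The Riemann sums of the germ over partitions with cells of size at most e.
Working with the set of values makes concatenation of partitions, hence additivity
of the limit, immediate. *)
Definition riemann_value (e s t : R) (v : E) : Prop := exists l,
  [/\ path <=%R s l, last s l = t, path (fun x y => W x y <= e) s l &
      v = rsum g s l].

Lemma riemann_value_le e e' s t v : e <= e' ->
  riemann_value e s t v -> riemann_value e' s t v.
Proof.
move=> ee' [l [pl el ml ->]]; exists l; split=> //.
by apply: sub_path ml => x y /le_trans; apply.
Qed.

Lemma riemann_value_cat e s u t v v' :
  riemann_value e s u v -> riemann_value e u t v' -> riemann_value e s t (v + v').
Proof.
move=> [l [pl el ml ->]] [l' [pl' el' ml' ->]]; exists (l ++ l').
by rewrite !cat_path last_cat rsum_cat el pl ml; split.
Qed.

Lemma riemann_value_germ e s t v : S <= s -> s <= t -> t <= T ->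
  riemann_value e s t v -> `|v - g s t| <= C' * W s t `^ th.
Proof.
by move=> Ss st tT [l [pl el ml ->]]; rewrite -el; apply: rsum_close; rewrite ?el.
Qed.

(** Both sums are compared with the sum over the common refinement, obtained by
sorting the union of the two lists of points. *)
Lemma riemann_value_close e s t v v' : 0 < e -> S <= s -> s <= t -> t <= T ->
  riemann_value e s t v -> riemann_value e s t v' ->
  `|v - v'| <= 2 * (C' * e `^ (th - 1) * W s t).
Proof.
move=> e0 Ss st tT [l [pl el ml ->]] [l' [pl' el' ml' ->]].
have tr : transitive (<=%R : rel R) by exact: le_trans.
have tot : total (<=%R : rel R) by exact: le_total.
set L := sort <=%R (l ++ l').
have lL : subseq l L.
  by apply: sorted_subseq_sort => //; [exact: prefix_subseq | exact: path_sorted pl].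
have l'L : subseq l' L.
  by apply: sorted_subseq_sort => //; [exact: suffix_subseq | exact: path_sorted pl'].
have pL : path <=%R s L.
  move: pl pl'; rewrite !path_sortedE//; move=> /andP[a1 _] /andP[a2 _].
  by rewrite sort_sorted// andbT all_sort all_cat a1.
have eL : last s L = t.
  apply/eqP; rewrite eq_le; apply/andP; split.
    have := mem_last s L; rewrite inE mem_sort mem_cat => /predU1P[->//|/orP[] h].
      by rewrite -el; apply: path_le_last; rewrite // inE h orbT.
    by rewrite -el'; apply: path_le_last; rewrite // inE h orbT.
  apply: path_le_last => //; rewrite -el; have := mem_last s l.
  by rewrite !inE mem_sort mem_cat => /orP[->|->]//; rewrite orbT.
have h := @rsum_refine _ _ _ _ e0 Ss lL pL; rewrite el in h.
have h' := @rsum_refine _ _ _ _ e0 Ss l'L pL; rewrite el' in h'.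
rewrite (_ : rsum g s l - _ =
  (rsum g s L - rsum g s l') - (rsum g s L - rsum g s l)); last first.
  by rewrite opprB [RHS]addrC addrA subrK.
apply: le_trans (ler_normB _ _) _.
by rewrite mulr2n mulrDl mul1r lerD// ?h ?h'.
Qed.

(** The sets of Riemann values, for e tending to 0, generate a Cauchy filter. *)
Lemma riemann_value_lim s t : S <= s -> s <= t -> t <= T ->
  exists G : E, forall d, 0 < d -> exists2 e, 0 < e &
    forall v, riemann_value e s t v -> `|v - G| <= d.
Proof.
move=> Ss st tT; have W0 := hc_ge0 HW Ss st tT.
pose F : set_system E :=
  [set A | exists2 e : R, 0 < e & riemann_value e s t `<=` A].
have FF : ProperFilter F.
  split.
    move=> [e e0 /= Fe]; have [l [pl el ml]] := hc_partition e0 Ss st tT.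
    by apply: (Fe (rsum g s l)); exists l.
  split.
  - by exists 1.
  - move=> A B [e e0 Ae] [e' e'0 Be]; exists (Num.min e e').
      by rewrite lt_min e0.
    by move=> v hv; split; [apply: Ae|apply: Be]; apply: riemann_value_le hv;
       rewrite ge_min lexx ?orbT.
  - by move=> A B AB [e e0 Ae]; exists e => // v /Ae /AB.
have small d : 0 < d -> exists2 e, 0 < e & forall v v',
    riemann_value e s t v -> riemann_value e s t v' -> `|v - v'| <= d.
  move=> d0; have [||e e0 He] := @powR_small _ (th - 1) (2 * (C' * W s t)) d _ _ d0.
  - by rewrite subr_gt0.
  - by rewrite mulr_ge0// mulr_ge0.
  exists e => // v v' hv hv'; apply: le_trans (riemann_value_close e0 Ss st tT hv hv') _.
  by apply: le_trans He; rewrite !mulrA (mulrAC _ (W s t)).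
have cF : cvg F.
  apply/cauchy_cvgP; apply/cauchy_ballP => d d0.
  have [e e0 He] := small (d / 2) (divr_gt0 d0 (ltr0Sn _ 1)).
  have Fe : F (riemann_value e s t) by exists e.
  exists (riemann_value e s t, riemann_value e s t) => //= -[v v'] /= [hv hv'].
  rewrite -ball_normE /=; apply: le_lt_trans (He _ _ hv hv') _; lra.
exists (lim F) => d d0.
have [e e0 He] := small (d / 2) (divr_gt0 d0 (ltr0Sn _ 1)); exists e => // v hv.
have d20 : 0 < d / 2 by rewrite divr_gt0.
have : F (ball (lim F) (d / 2)) by apply: cF; exact: nbhsx_ballx.
case=> e' e'0 Fe'.
have ee'0 : 0 < Num.min e e' by rewrite lt_min e0.
have [l [pl el ml]] := hc_partition ee'0 Ss st tT.
have hv' : riemann_value (Num.min e e') s t (rsum g s l) by exists l.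
have h1 : `|v - rsum g s l| <= d / 2.
  by apply: He => //; apply: riemann_value_le hv'; rewrite ge_min lexx.
have : ball (lim F) (d / 2) (rsum g s l).
  by apply: Fe'; apply: riemann_value_le hv'; rewrite ge_min lexx orbT.
rewrite -ball_normE /= distrC => h2.
rewrite (_ : v - lim F = (v - rsum g s l) + (rsum g s l - lim F)); last by rewrite addrA subrK.
by apply: le_trans (ler_normD _ _) _; lra.
Qed.

(** The sewing lemma: a germ that is additive up to O(W^th), th > 1, lies within
O(W^th) of an additive map, namely the limit of its Riemann sums. *)
Lemma sewing : exists (G : R -> R -> E) (K : R), [/\ 0 <= K,
  (forall s u t, S <= s -> s <= u -> u <= t -> t <= T -> G s t = G s u + G u t) &
  (forall s t, S <= s -> s <= t -> t <= T -> `|G s t - g s t| <= K * W s t `^ th)].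
Proof.
pose P s t (G : E) := forall d, 0 < d -> exists2 e, 0 < e &
    forall v, riemann_value e s t v -> `|v - G| <= d.
pose G s t := xget 0 (P s t).
have GP s t : S <= s -> s <= t -> t <= T -> P s t (G s t).
  move=> Ss st tT; have [x Px] := riemann_value_lim Ss st tT.
  exact: (xgetI 0 Px).
exists G, C'; split=> //.
- move=> s u t Ss su ut tT.
  have st := le_trans su ut; have Su := le_trans Ss su; have uT := le_trans ut tT.
  apply/eqP; rewrite -subr_eq0 -normr_le0; apply/ler_addgt0Pr => d d0; rewrite add0r.
  have d3 : 0 < d / 3 by rewrite divr_gt0.
  have [e1 e10 h1] := GP _ _ Ss st tT _ d3.
  have [e2 e20 h2] := GP _ _ Ss su uT _ d3.
  have [e3 e30 h3] := GP _ _ Su ut tT _ d3.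
  pose e := Num.min e1 (Num.min e2 e3).
  have e0 : 0 < e by rewrite !lt_min e10 e20.
  have [l [pl el ml]] := hc_partition e0 Ss su uT.
  have [l' [pl' el' ml']] := hc_partition e0 Su ut tT.
  have r : riemann_value e s u (rsum g s l) by exists l.
  have r' : riemann_value e u t (rsum g u l') by exists l'.
  have := h1 _ (riemann_value_le _ (riemann_value_cat r r')).
  have := h2 _ (riemann_value_le _ r).
  have := h3 _ (riemann_value_le _ r').
  rewrite /e !ge_min !lexx !orbT => /(_ isT) k3 /(_ isT) k2 /(_ isT) k1.
  set v := rsum g s l in k1 k2 k3; set v' := rsum g u l' in k1 k2 k3.
  have -> : G s t - (G s u + G u t) =
     (v - G s u) + (v' - G u t) - (v + v' - G s t).
    by rewrite [X in _ = X - _]addrACA -opprD opprB [RHS]addrC addrA subrK.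
  apply: le_trans (ler_normB _ _) _.
  by apply: le_trans (lerD (ler_normD _ _) (lexx _)) _; lra.
- move=> s t Ss st tT; apply/ler_addgt0Pr => d d0.
  have [e e0 he] := GP _ _ Ss st tT _ d0.
  have [l [pl el ml]] := hc_partition e0 Ss st tT.
  have r : riemann_value e s t (rsum g s l) by exists l.
  have h1 := he _ r; have h2 := riemann_value_germ Ss st tT r.
  rewrite -(subrK (rsum g s l) (G s t)) -addrA.
  by apply: le_trans (ler_normD _ _) _; rewrite distrC in h1; lra.
Qed.

End Target.
End Sewing.

(** * Controls on the simplex *)

Section SimplexPoints.
Context {R : realType} {S T : R} (ST : S <= T).

Definition clamp (a : R) : R := Num.max S (Num.min a T).

Lemma retract_subproof (a b : R) :
  (clamp a, Num.max (clamp a) (clamp b)) \in simplex S T.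
Proof.
rewrite inE; split=> /=.
- by rewrite le_max lexx.
- by rewrite le_max lexx.
- by rewrite !ge_max ST !ge_min !lexx !orbT.
Qed.

(** A continuous retraction of the plane onto the simplex; it turns functions on the
simplex into functions of two real variables. *)
Definition retract (a b : R) : simplex S T := 
  exist (fun x => x \in simplex S T) _ (retract_subproof a b).

Lemma retractE a b : S <= a -> a <= b -> b <= T -> val (retract a b) = (a, b).
Proof.
move=> Sa ab bT; rewrite /= /clamp.
have aT := le_trans ab bT; have Sb := le_trans Sa ab.
by rewrite (min_idPl aT) (min_idPl bT) (max_idPr Sa) (max_idPr Sb) (max_idPr ab).
Qed.

Lemma simplexP (x : simplex S T) :
  [/\ S <= (val x).1, (val x).1 <= (val x).2 & (val x).2 <= T].
Proof. by have := valP x; rewrite inE. Qed.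

Lemma retract_val (x : simplex S T) : retract (val x).1 (val x).2 = x.
Proof.
by have [h1 h2 h3] := simplexP x; apply: val_inj; rewrite retractE//; case: (val x).
Qed.

Lemma chained_retract a b c : S <= a -> a <= b -> b <= c -> c <= T ->
  chained (retract a b) (retract b c) (retract a c).
Proof.
move=> Sa ab bc cT; have bT := le_trans bc cT; have Sb := le_trans Sa ab.
by rewrite /chained !retractE// (le_trans ab).
Qed.

Lemma val_continuous : continuous (fun x : simplex S T => val x : R * R).
Proof. exact: initial_continuous. Qed.

Lemma retract_continuous (X : topologicalType) (f g : X -> R) (x : X) :
  {for x, continuous f} -> {for x, continuous g} ->
  {for x, continuous (fun y => retract (f y) (g y))}.
Proof.
move=> cf cg.
pose h (z : R * R) := retract z.1 z.2.
have ch : continuous h.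
  apply: continuous_comp_initial => z.
  have cl (u : R * R -> R) : continuous u ->
      continuous (fun z => clamp (u z) : R^o).
    move=> cu y.
    have c1 : {for y, continuous ((u : _ -> R^o) \min cst T)}.
      by apply: continuous_min; [exact: cu | exact: cvg_cst].
    by apply: (@continuous_max R _ (cst S) _ y _ c1); exact: cvg_cst.
  have c1 : {for z, continuous (fun z : R * R => clamp z.1 : R^o)}.
    by apply: (cl fst) => y; exact: cvg_fst.
  have c2 : {for z, continuous (fun z : R * R => clamp z.2 : R^o)}.
    by apply: (cl snd) => y; exact: cvg_snd.
  exact: (cvg_pair c1 (@continuous_max R _ _ _ z c1 c2)).
apply: (@continuous_comp _ _ _ (fun y => (f y, g y)) h); last exact: ch.
exact: (cvg_pair cf cg).
Qed.

End SimplexPoints.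

Section Controls.
Context {R : realType} {S T : R} (ST : S <= T) (w : simplex S T -> R).
Hypothesis cw : control w.

Definition ctrl s t := w (retract ST s t).

Lemma ctrl_continuous (X : topologicalType) (f g : X -> R) (x : X) :
  {for x, continuous f} -> {for x, continuous g} ->
  {for x, continuous (fun y => ctrl (f y) (g y))}.
Proof.
move=> cf cg; case: cw => cw' _ _ _.
apply: (@continuous_comp _ _ _ (fun y => retract ST (f y) (g y)) w); last exact: cw'.
exact: retract_continuous.
Qed.

Lemma ctrl_diag a : S <= a -> a <= T -> ctrl a a = 0.
Proof. by move=> Sa aT; case: cw => _ _ h _; apply: h; rewrite retractE. Qed.

(** Halving is the intermediate value theorem for u |-> w(s,u) - w(u,t): at a zero the
two parts are equal and their sum is at most w(s,t). *)
Lemma ctrl_halvable : halvable_control S T ctrl.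
Proof.
case: (cw) => cw1 cw2 cw3 cw4; split.
- by move=> s t *; exact: cw2.
- by move=> s u t Ss su ut tT; apply: cw4; exact: chained_retract.
- move=> s t Ss st tT.
  pose f u := ctrl s u - ctrl u t.
  have cf : {within `[s, t], continuous f}.
    apply: continuous_subspaceT => u.
    by apply: cvgB; apply: ctrl_continuous;
      [exact: cvg_cst|exact: cvg_id|exact: cvg_id|exact: cvg_cst].
  have sT := le_trans st tT; have St := le_trans Ss st.
  have [|u] := @IVT _ f s t 0 st cf.
    rewrite /f !ctrl_diag// subr0 sub0r ge_min le_max !oppr_le0.
    by rewrite /ctrl !cw2 orbT.
  rewrite in_itv /= => /andP[su ut] /eqP; rewrite subr_eq0 => /eqP e.
  have sup : ctrl s u + ctrl u t <= ctrl s t.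
    by apply: cw4; exact: chained_retract.
  by exists u; split=> //; lra.
Qed.

Lemma ctrl_val x : ctrl (val x).1 (val x).2 = w x.
Proof. by rewrite /ctrl retract_val. Qed.

Lemma control_le_chained x y z : chained x y z -> w x <= w z /\ w y <= w z.
Proof.
case: cw => _ h0 _ h /h; have := h0 x; have := h0 y; lra.
Qed.

Lemma control_bounded : exists2 M, 0 < M & forall x, w x <= M.
Proof.
exists (ctrl S T + 1).
  by case: cw => _ h _ _; rewrite ltr_wpDl// h.
move=> x; have [h1 h2 h3] := simplexP x.
rewrite -[w x]ctrl_val.
have aT := le_trans h2 h3.
have [_ k1] := control_le_chained (chained_retract ST (lexx S) h1 aT (lexx T)).
have [k2 _] := control_le_chained (chained_retract ST h1 h2 h3 (lexx T)).
by rewrite /ctrl; lra.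
Qed.

(** Two points of the simplex are both compared with the smallest interval that
contains them; w of the extra pieces tends to 0 because w vanishes on the diagonal. *)
Lemma continuous_of_increments (E : normedModType R) (Y : simplex S T -> E) a C :
  0 < a -> 0 <= C ->
  (forall x y z, chained x y z ->
     `|Y z - Y x| <= C * w y `^ a /\ `|Y z - Y y| <= C * w x `^ a) ->
  continuous Y.
Proof.
move=> a0 C0 HY x; have FF := nbhs_filter x; apply/(@cvgrPdist_le _ _ _ _ FF) => d d0.
have [e e0 he] := powR_small a0 C0 (divr_gt0 d0 (ltr0Sn R 3)).
have [x1 x12 x2] := simplexP x.
pose p1 (y : simplex S T) : R := (val y).1.
pose p2 (y : simplex S T) : R := (val y).2.
have c1 : {for x, continuous p1}.
  apply: (@continuous_comp _ _ _ (fun y : simplex S T => val y : R * R) fst).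
    exact: val_continuous.
  exact: cvg_fst.
have c2 : {for x, continuous p2}.
  apply: (@continuous_comp _ _ _ (fun y : simplex S T => val y : R * R) snd).
    exact: val_continuous.
  exact: cvg_snd.
have cc1 : {for x, continuous (cst (p1 x) : simplex S T -> R)} by exact: cvg_cst.
have cc2 : {for x, continuous (cst (p2 x) : simplex S T -> R)} by exact: cvg_cst.
have cmin : {for x, continuous (fun y => Num.min (p1 y) (p1 x))}.
  exact: (@continuous_min R _ _ _ x c1 cc1).
have cmax : {for x, continuous (fun y => Num.max (p2 y) (p2 x))}.
  exact: (@continuous_max R _ _ _ x c2 cc2).
have x1T := le_trans x12 x2; have Sx2 := le_trans x1 x12.
have small (f g : simplex S T -> R) :
    {for x, continuous f} -> {for x, continuous g} ->
    f x = g x -> S <= f x <= T -> \forall y \near x, ctrl (f y) (g y) < e.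
  move=> cf cg fg /andP[Sf fT].
  apply: (@cvgr_lt _ _ _ FF _ _ (ctrl_continuous cf cg)).
  by rewrite -fg ctrl_diag.
have n1 : \forall y \near x, ctrl (Num.min (p1 y) (p1 x)) (p1 y) < e.
  by apply: small; rewrite ?minxx// x1.
have n2 : \forall y \near x, ctrl (Num.min (p1 y) (p1 x)) (p1 x) < e.
  by apply: small; rewrite ?minxx// x1.
have n3 : \forall y \near x, ctrl (p2 y) (Num.max (p2 y) (p2 x)) < e.
  by apply: small; rewrite ?maxxx// Sx2.
have n4 : \forall y \near x, ctrl (p2 x) (Num.max (p2 y) (p2 x)) < e.
  by apply: small; rewrite ?maxxx// Sx2.
have step s t s' t' : S <= s' -> s' <= s -> s <= t -> t <= t' -> t' <= T ->
    ctrl s' s < e -> ctrl t t' < e ->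
    `|Y (retract ST s' t') - Y (retract ST s t)| <= d / 2.
  move=> h1 h2 h3 h4 h5 w1 w2.
  have small' v : 0 <= v -> v < e -> C * v `^ a <= d / 4.
    move=> v0 ve; apply: le_trans he; rewrite ler_wpM2l// ge0_ler_powR//.
    - exact: ltW. - exact: ltW. - exact: ltW.
  have [_ wge0 _ _] := cw.
  have [_ k1] := HY _ _ _ (chained_retract ST h1 h2 h3 (le_trans h4 h5)).
  have [k2 _] := HY _ _ _ (chained_retract ST h1 (le_trans h2 h3) h4 h5).
  have k1' := le_trans k1 (small' _ (wge0 _) w1).
  have k2' := le_trans k2 (small' _ (wge0 _) w2).
  rewrite -(subrK (Y (retract ST s' t)) (Y (retract ST s' t'))) -addrA.
  by apply: le_trans (ler_normD _ _) _; lra.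
(* The interval [s, t] below is the hull of x and y. *)
near=> y.
have q1 : ctrl (Num.min (p1 y) (p1 x)) (p1 y) < e by near: y.
have q2 : ctrl (Num.min (p1 y) (p1 x)) (p1 x) < e by near: y.
have q3 : ctrl (p2 y) (Num.max (p2 y) (p2 x)) < e by near: y.
have q4 : ctrl (p2 x) (Num.max (p2 y) (p2 x)) < e by near: y.
have [y1 y12 y2] := simplexP y.
set s := Num.min (p1 y) (p1 x); set t := Num.max (p2 y) (p2 x).
have Ss : S <= s by rewrite le_min y1.
have tT : t <= T by rewrite ge_max y2.
have hy : `|Y (retract ST s t) - Y y| <= d / 2.
  rewrite -[in X in _ - X](retract_val ST y); apply: step => //.
  - by rewrite ge_min lexx.
  - by rewrite le_max lexx.
have hx : `|Y (retract ST s t) - Y x| <= d / 2.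
  rewrite -[in X in _ - X](retract_val ST x); apply: step => //.
  - by rewrite ge_min lexx orbT.
  - by rewrite le_max lexx orbT.
rewrite -(subrK (Y (retract ST s t)) (Y x)) -addrA.
by apply: le_trans (ler_normD _ _) _; rewrite distrC; lra.
Unshelve. all: by end_near. Qed.

End Controls.

Lemma controlD {R : realType} {S T : R} (w w' : simplex S T -> R) :
  control w -> control w' -> control (fun x => w x + w' x).
Proof.
move=> [c1 c2 c3 c4] [d1 d2 d3 d4]; split.
- move=> x; have FF := nbhs_filter x.
  exact: (@cvgD _ _ _ _ FF _ _ _ _ (c1 x) (d1 x)).
- by move=> x; rewrite addr_ge0.
- by move=> x e; rewrite c3// d3// addr0.
- by move=> x y z h; rewrite addrACA lerD ?c4 ?d4.
Qed.

Lemma powR_le_bounded {R : realType} (M a b v : R) : 0 < b -> b <= a ->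
  0 <= v -> v <= M -> v `^ a <= M `^ (a - b) * v `^ b.
Proof.
move=> b0 ba v0 vM.
have -> : v `^ a = v `^ (a - b) * v `^ b.
  by rewrite -powRD ?subrK// (gt_eqF (lt_le_trans b0 ba)).
by rewrite ler_wpM2r ?powR_ge0// ge0_ler_powR ?nnegrE ?subr_ge0// (le_trans v0).
Qed.

(** * The truncated tensor algebra *)

Lemma big_nat_only (V : nmodType) (m n l0 : nat) (f : nat -> V) :
  (forall l, (m <= l < n)%N -> l != l0 -> f l = 0) ->
  \sum_(m <= l < n) f l = if (m <= l0 < n)%N then f l0 else 0.
Proof.
move=> f0; case: ifPn => [h|/negP h]; last first.
  rewrite big_nat big1// => l hl; apply: f0 => //.
  by apply/eqP => e; apply: h; rewrite -e.
rewrite (bigD1_seq l0) ?mem_index_iota ?iota_uniq//=.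
by rewrite big_nat_cond big1 ?addr0// => l /andP[]; exact: f0.
Qed.

Section TensorAlgebra.
Context {R : realType} {V : completeNormedModType R} {A : tensor_data V}.
Hypothesis HA : admissible_tensor_powers A.
Implicit Types (a b c : tseq A).

(** Products that land in level n by definition: the grading equations of the
tensor algebra no longer appear in statements, and sums may run over all pairs of
levels since off-degree products vanish. *)
Definition tmul_to n i j (x : tpow A i) (y : tpow A j) : tpow A n :=
  match @eqP nat (i + j)%N n with
  | ReflectT e => tpow_cast e (tmul x y)
  | ReflectF _ => 0
  end.

Lemma tmul_toE n i j (e : (i + j)%N = n) (x : tpow A i) (y : tpow A j) :
  tmul_to n x y = tpow_cast e (tmul x y).
Proof.
rewrite /tmul_to; case: eqP => [e'|//]; by rewrite (eq_irrelevance e' e).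
Qed.

Lemma tmul_to_eq0 n i j (x : tpow A i) (y : tpow A j) :
  (i + j)%N != n -> tmul_to n x y = 0.
Proof. by rewrite /tmul_to; case: eqP. Qed.

Lemma tpow_cast_norm m n (e : m = n) (x : tpow A m) : `|tpow_cast e x| = `|x|.
Proof. by case: n / e. Qed.

Lemma tmul_toDr n i j (x : tpow A i) (y z : tpow A j) :
  tmul_to n x (y + z) = tmul_to n x y + tmul_to n x z.
Proof.
case: (eqVneq (i + j)%N n) => [e|h]; last by rewrite !tmul_to_eq0 ?addr0.
rewrite !tmul_toE; case: n / e => /=.
by have := tmul_linear_r HA x 1 y z; rewrite !scale1r.
Qed.

Lemma tmul_toDl n i j (x y : tpow A i) (z : tpow A j) :
  tmul_to n (x + y) z = tmul_to n x z + tmul_to n y z.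
Proof.
case: (eqVneq (i + j)%N n) => [e|h]; last by rewrite !tmul_to_eq0 ?addr0.
rewrite !tmul_toE; case: n / e => /=.
by have := tmul_linear_l HA z 1 x y; rewrite !scale1r.
Qed.

Lemma tmul_to0r n i j (x : tpow A i) : tmul_to n x (0 : tpow A j) = 0.
Proof. by apply: (addrI (tmul_to n x (0 : tpow A j))); rewrite -tmul_toDr !addr0. Qed.

Lemma tmul_to0l n i j (x : tpow A j) : tmul_to n (0 : tpow A i) x = 0.
Proof. by apply: (addrI (tmul_to n (0 : tpow A i) x)); rewrite -tmul_toDl !addr0. Qed.

Lemma tmul_to_sumr n i j (x : tpow A i) (I : Type) (r : seq I) (F : I -> tpow A j) :
  tmul_to n x (\sum_(k <- r) F k) = \sum_(k <- r) tmul_to n x (F k).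
Proof.
by elim: r => [|k r IH]; rewrite ?big_nil ?tmul_to0r// !big_cons tmul_toDr IH.
Qed.

Lemma tmul_to_suml n i j (y : tpow A j) (I : Type) (r : seq I) (F : I -> tpow A i) :
  tmul_to n (\sum_(k <- r) F k) y = \sum_(k <- r) tmul_to n (F k) y.
Proof.
by elim: r => [|k r IH]; rewrite ?big_nil ?tmul_to0l// !big_cons tmul_toDl IH.
Qed.

Lemma tmul_to_norm n i j (x : tpow A i) (y : tpow A j) :
  `|tmul_to n x y| <= `|x| * `|y|.
Proof.
case: (eqVneq (i + j)%N n) => [e|h]; last by rewrite tmul_to_eq0 ?normr0 ?mulr_ge0.
by rewrite tmul_toE tpow_cast_norm tmul_norm.
Qed.

Lemma tmul_to_assoc n i j l (x : tpow A i) (y : tpow A j) (z : tpow A l) :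
  tmul_to n x (tmul_to (j + l) y z) = tmul_to n (tmul_to (i + j) x y) z.
Proof.
rewrite (tmul_toE (erefl (j + l)%N)) (tmul_toE (erefl (i + j)%N)) /=.
case: (eqVneq (i + j + l)%N n) => [e|h]; last by rewrite !tmul_to_eq0 ?addnA.
have e' : (i + (j + l))%N = n by rewrite addnA.
rewrite (tmul_toE e) (tmul_toE e'); case: n / e e' => e' /=.
by rewrite -(tmulA HA) (eq_irrelevance e' (addnA i j l)).
Qed.

Lemma tmul_to1l n (x : tpow A n) : tmul_to n (tscal A 1) x = x.
Proof.
rewrite (tmul_toE (add0n n)) (eq_irrelevance (add0n n) (erefl n)) /=.
by rewrite (tmul_scal_l HA) scale1r.
Qed.

Lemma tmul_to1r n (x : tpow A n) : tmul_to n x (tscal A 1) = x.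
Proof. by rewrite (tmul_toE (addn0 n)) (tmul_scal_r HA) scale1r. Qed.

Lemma tprodE k a b n : (n <= k)%N ->
  tprod k a b n = \sum_(0 <= j < n.+1) tmul_to n (a j) (b (n - j)%N).
Proof.
move=> nk; rewrite /tprod nk big_mkord; apply: eq_bigr => j _.
by rewrite (tmul_toE (subnKC (leq_ord j))).
Qed.

(** The part of level n of a product that involves neither end level; the bound N
is any number with N >= n, and keeping it apart from n lets the lower levels be
written with the same index range. *)
Definition cross N n a b : tpow A n :=
  \sum_(1 <= i < N) \sum_(1 <= j < N) tmul_to n (a i) (b j).

Lemma tprod_cross k N n a b : (0 < n)%N -> (n <= N)%N -> (n <= k)%N ->
  a 0%N = tscal A 1 -> b 0%N = tscal A 1 ->
  tprod k a b n = a n + b n + cross N n a b.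
Proof.
case: n => // n _ nN nk a0 b0; rewrite tprodE//.
rewrite big_nat_recl// big_nat_recr//= a0 subn0 tmul_to1l subnn b0 tmul_to1r.
rewrite addrA addrAC (addrC (b _)); congr (_ + _).
rewrite [LHS](_ : _ = \sum_(1 <= i < n.+1) tmul_to n.+1 (a i) (b (n.+1 - i)%N)); last first.
  by rewrite big_add1.
rewrite /cross.
have E i : (1 <= i < N)%N ->
   \sum_(1 <= j < N) tmul_to n.+1 (a i) (b j) =
   if (i < n.+1)%N then tmul_to n.+1 (a i) (b (n.+1 - i)%N) else 0.
  move=> /andP[i1 iN]; rewrite (@big_nat_only _ _ _ (n.+1 - i)%N).
    have -> : (1 <= n.+1 - i < N)%N = (i < n.+1)%N by lia.
    by [].
  by move=> l hl hne; rewrite tmul_to_eq0//; lia.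
rewrite [RHS](eq_big_nat _ _ E) -big_mkcond /=.
by rewrite (big_nat_widen 1 n.+1 N).
Qed.

Lemma cross_addl N n a a' b : 
  cross N n (fun i => a i + a' i) b = cross N n a b + cross N n a' b.
Proof.
rewrite /cross -big_split; apply: eq_bigr => i _; rewrite -big_split.
by apply: eq_bigr => j _; rewrite tmul_toDl.
Qed.

Lemma cross_addr N n a b b' : 
  cross N n a (fun i => b i + b' i) = cross N n a b + cross N n a b'.
Proof.
rewrite /cross -big_split; apply: eq_bigr => i _; rewrite -big_split.
by apply: eq_bigr => j _; rewrite tmul_toDr.
Qed.

Lemma eq_cross N n a a' b b' :
  (forall i, (0 < i < N)%N -> a i = a' i) ->
  (forall i, (0 < i < N)%N -> b i = b' i) -> cross N n a b = cross N n a' b'.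
Proof.
move=> ha hb; apply: eq_big_nat => i hi; apply: eq_big_nat => j hj.
by rewrite ha ?hb.
Qed.

(** Both sides are the sum of a_i b_j c_l over i + j + l = n with i, j, l > 0. *)
Lemma cross_assoc n a b c :
  cross n n a (fun m => cross n m b c) = cross n n (fun m => cross n m a b) c.
Proof.
transitivity (\sum_(1 <= i < n) \sum_(1 <= j < n) \sum_(1 <= l < n)
    tmul_to n (a i) (tmul_to (j + l) (b j) (c l))).
  apply: eq_big_nat => i hi.
  under eq_bigr => m _.
    rewrite tmul_to_sumr; under eq_bigr => j _ do rewrite tmul_to_sumr.
    over.
  rewrite exchange_big; apply: eq_big_nat => j hj /=.
  rewrite exchange_big; apply: eq_big_nat => l hl /=.
  rewrite (@big_nat_only _ _ _ (j + l)%N).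
    by case: ifP => // h; rewrite tmul_to_eq0//; lia.
  by move=> m hm hne; rewrite (@tmul_to_eq0 m)// ?tmul_to0r// eq_sym.
transitivity (\sum_(1 <= i < n) \sum_(1 <= j < n) \sum_(1 <= l < n)
    tmul_to n (tmul_to (i + j) (a i) (b j)) (c l)).
  by do 3![apply: eq_bigr => ? _]; exact: tmul_to_assoc.
symmetry; rewrite {1}/cross.
under eq_bigr => m _.
  under eq_bigr => l _.
    rewrite /cross tmul_to_suml; under eq_bigr => i _ do rewrite tmul_to_suml.
    over.
  rewrite exchange_big.
  under eq_bigr => i _ do rewrite exchange_big.
  over.
rewrite exchange_big; apply: eq_big_nat => i hi /=.
rewrite exchange_big; apply: eq_big_nat => j hj /=.
rewrite exchange_big; apply: eq_big_nat => l hl /=.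
rewrite (@big_nat_only _ _ _ (i + j)%N).
  by case: ifP => // h; rewrite tmul_to_eq0//; lia.
by move=> m hm hne; rewrite (@tmul_to_eq0 m)// ?tmul_to0l// eq_sym.
Qed.

(** For a = Z_{r,s}, b = Z_{s,u}, c = Z_{u,t}, this computes the defect of additivity
of the germ (s,t) |-> cross(Z_{r,s}, Z_{s,t}). *)
Lemma cross_cocycle n a b c ab bc :
  (forall i, (0 < i < n)%N -> ab i = a i + b i + cross n i a b) ->
  (forall i, (0 < i < n)%N -> bc i = b i + c i + cross n i b c) ->
  cross n n a bc + cross n n b c = cross n n a b + cross n n ab c.
Proof.
move=> hab hbc.
rewrite (@eq_cross _ _ a a bc (fun i => b i + c i + cross n i b c))//.
rewrite (@eq_cross _ _ ab (fun i => a i + b i + cross n i a b) c c)//.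
rewrite !cross_addr !cross_addl cross_assoc.
by rewrite -!addrA; congr (_ + (_ + _)); rewrite addrC.
Qed.

Lemma cross_norm N n a b : `|cross N n a b| <=
  \sum_(1 <= i < N) \sum_(1 <= j < N) if (i + j == n)%N then `|a i| * `|b j| else 0.
Proof.
rewrite /cross; apply: le_trans (ler_norm_sum _ _ _) _; apply: ler_sum => i _.
apply: le_trans (ler_norm_sum _ _ _) _; apply: ler_sum => j _.
by case: ifP => [_|/negbT h]; [exact: tmul_to_norm | rewrite tmul_to_eq0 ?normr0].
Qed.

End TensorAlgebra.

(** * Multiplicative functionals and Lyons' extension *)

Lemma uniform_const (R : realType) k (P : nat -> R -> Prop) :
  (forall i c c', P i c -> c <= c' -> P i c') ->
  (forall i, (1 <= i <= k)%N -> exists c, P i c) ->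
  exists2 c, 0 <= c & forall i, (1 <= i <= k)%N -> P i c.
Proof.
move=> mP; elim: k => [|k IH] hP; first by exists 0 => // i; case: i.
have [c c0 hc] := IH (fun i hi => hP i (ltac:(lia))).
have [|c' hc'] := hP k.+1; first by rewrite /= leqnn.
exists (Num.max c c'); first by rewrite le_max c0.
move=> i /andP[i1]; rewrite leq_eqVlt => /predU1P[->|ik].
  by apply: mP hc' _; rewrite le_max lexx orbT.
by apply: mP (hc i _) _; rewrite ?le_max ?lexx// i1.
Qed.

Section Decay.
Context {R : realType} {S T : R}.
Implicit Types w : simplex S T -> R.

Definition decays w (a : R) (E : normedModType R) (f : simplex S T -> E) : Prop :=
  exists2 C, 0 <= C & forall x, `|f x| <= C * w x `^ a.

Lemma decaysD w a (E : normedModType R) (f g : simplex S T -> E) :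
  decays w a f -> decays w a g -> decays w a (fun x => f x + g x).
Proof.
move=> [C C0 hf] [C' C'0 hg]; exists (C + C'); first by rewrite addr_ge0.
by move=> x; rewrite mulrDl (le_trans (ler_normD _ _))// lerD.
Qed.

Lemma decaysB w a (E : normedModType R) (f g : simplex S T -> E) :
  decays w a f -> decays w a g -> decays w a (fun x => f x - g x).
Proof.
move=> df [C C0 hg]; apply: decaysD => //; exists C => // x.
by rewrite normrN.
Qed.

(** A control is bounded, so a larger exponent gives a stronger estimate. *)
Lemma decays_weaken w a b (E : normedModType R) (f : simplex S T -> E) :
  S <= T -> control w -> 0 < b -> b <= a -> decays w a f -> decays w b f.
Proof.
move=> ST cw b0 ba [C C0 hf]; have [M M0 hM] := control_bounded ST cw.
exists (C * M `^ (a - b)); first by rewrite mulr_ge0 ?powR_ge0.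
move=> x; apply: le_trans (hf x) _; rewrite -mulrA ler_wpM2l//.
by case: cw => _ w0 _ _; exact: powR_le_bounded.
Qed.

Lemma decays_control_le w w' a (E : normedModType R) (f : simplex S T -> E) :
  0 <= a -> (forall x, 0 <= w x) -> (forall x, w x <= w' x) ->
  decays w a f -> decays w' a f.
Proof.
move=> a0 w0 ww' [C C0 hf]; exists C => // x; apply: le_trans (hf x) _.
by rewrite ler_wpM2l// ge0_ler_powR ?nnegrE// (le_trans (w0 x)).
Qed.

Lemma decays_eq w a (E : normedModType R) (f g : simplex S T -> E) :
  f =1 g -> decays w a f -> decays w a g.
Proof. by move=> fg [C C0 hf]; exists C => // x; rewrite -fg. Qed.

End Decay.

Section Functionals.
Context {R : realType} {V : completeNormedModType R} {A : tensor_data V}.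
Context {S T : R}.
Hypothesis HA : admissible_tensor_powers A.
Implicit Types (X Y Z H I : tmap A S T) (w : simplex S T -> R).

Lemma decays_uniform w (e : nat -> R) k X :
  (forall x, 0 <= w x) ->
  (forall i, (1 <= i <= k)%N -> decays w (e i) (fun x => X x i)) ->
  exists2 C, 0 <= C & forall i x, (1 <= i <= k)%N -> `|X x i| <= C * w x `^ e i.
Proof.
move=> w0 h.
have [||C C0 hC] := @uniform_const R k
  (fun i c => forall x, `|X x i| <= c * w x `^ e i).
- by move=> i c c' hc cc' x; rewrite (le_trans (hc x))// ler_wpM2r ?powR_ge0.
- by move=> i /h[C _ hC]; exists C.
- by exists C => // i x /hC.
Qed.

(** The positive constants beta(p) and (i/p)! are absorbed into K. *)
Lemma finite_variationP k p w X : 0 < p ->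
  (exists K, finite_variation k p w K X) <->
  (forall i, (1 <= i <= k)%N -> decays w (i%:R / p) (fun x => X x i)).
Proof.
move=> p0; have b0 := beta_cst_gt0 p0.
have g0 i : 0 < gfact (i%:R / p) by rewrite gfact_gt0// divr_ge0 ?(ltW p0).
split=> [[K hK] i hi|h].
  exists (`|K| / (beta_cst p * gfact (i%:R / p))).
    by rewrite divr_ge0 ?normr_ge0// ltW// mulr_gt0.
  move=> x; apply: le_trans (hK x i hi) _.
  rewrite [leRHS]mulrAC mulrA ler_wpM2r ?invr_ge0 ?(ltW (mulr_gt0 _ _))//.
  by rewrite ler_wpM2r ?powR_ge0 ?ler_norm.
have [||K K0 hK] := @uniform_const R k (fun i c => forall x,
  `|X x i| <= c * (w x `^ (i%:R / p) / (beta_cst p * gfact (i%:R / p)))).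
- move=> i c c' hc cc' x; rewrite (le_trans (hc x))// ler_wpM2r//.
  by rewrite divr_ge0 ?powR_ge0// ltW// mulr_gt0.
- move=> i /h[C C0 hC]; exists (C * (beta_cst p * gfact (i%:R / p))) => x.
  by rewrite mulrA mulrAC mulfK// gt_eqF// mulr_gt0.
- by exists K => x i /hK.
Qed.

Lemma mf_top k n X x y z : multiplicative_functional k X -> chained x y z ->
  (0 < n <= k)%N -> X z n = X x n + X y n + cross n n (X x) (X y).
Proof.
move=> [_ _ X1 XM] h /andP[n0 nk].
by rewrite -(XM _ _ _ h) (tprod_cross HA n0 (leqnn n) nk).
Qed.

Lemma mf_cross k n i X x y z : multiplicative_functional k X -> chained x y z ->
  (0 < i <= k)%N -> (i <= n)%N -> X z i = X x i + X y i + cross n i (X x) (X y).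
Proof.
move=> [_ _ X1 XM] h /andP[i0 ik] ni.
by rewrite -(XM _ _ _ h) (tprod_cross HA i0 ni ik).
Qed.

Lemma mf_ttrunc k j X : multiplicative_functional k X -> (j <= k)%N ->
  multiplicative_functional j (fun x => ttrunc j (X x)).
Proof.
move=> [X0 Xc X1 XM] jk; split.
- by move=> x i ji; rewrite /ttrunc leqNgt ji.
- move=> i; rewrite /ttrunc; case: leqP => _; [exact: Xc | exact: cst_continuous].
- by move=> x; rewrite /ttrunc leq0n X1.
- move=> x y z h; apply: functional_extensionality_dep => i.
  rewrite /ttrunc; case: leqP => ij; last by rewrite /tprod leqNgt ij.
  rewrite -(XM _ _ _ h) !tprodE// ?(leq_trans ij)//.
  by apply: eq_big_nat => l hl; rewrite !ifT//; lia.
Qed.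

(** The multiplicativity relation in a new top level involves the lower levels only
through the cross terms. *)
Lemma mf_extend j Z Y : multiplicative_functional j Z ->
  (forall x, truncated j.+1 (Y x)) ->
  (forall x i, (i <= j)%N -> Y x i = Z x i) ->
  continuous (fun x => Y x j.+1) ->
  (forall x y z, chained x y z ->
     Y z j.+1 = Y x j.+1 + Y y j.+1 + cross j.+1 j.+1 (Z x) (Z y)) ->
  multiplicative_functional j.+1 Y.
Proof.
move=> [Z0 Zc Z1 ZM] Y0 YZ Yc Yn; split => //.
- move=> i; case: (ltngtP i j.+1) => [ij|ij|->//].
    by rewrite (_ : (fun x => Y x i) = (fun x => Z x i)) //; apply: funext => x; exact: YZ.
  rewrite (_ : (fun x => Y x i) = (fun=> 0)); first exact: cst_continuous.
  by apply: funext => x; exact: Y0.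
- by move=> x; rewrite YZ.
- move=> x y z h; apply: functional_extensionality_dep => i.
  case: (ltngtP i j.+1) => [ij|ij|->].
  + rewrite tprodE 1?ltnW// YZ// -(ZM _ _ _ h) tprodE//.
    by apply: eq_big_nat => l hl; rewrite !YZ//; lia.
  + by rewrite /tprod leqNgt ij Y0.
  + rewrite (tprod_cross HA (ltn0Sn j) (leqnn _) (leqnn _)); try by rewrite YZ.
    rewrite (Yn _ _ _ h); congr (_ + _); apply: eq_cross => // l hl; rewrite YZ//; lia.
Qed.

Lemma cross_norm_le N n (a b : tseq A) (v : nat -> nat -> R) :
  (forall i l, (0 < i)%N -> (0 < l)%N -> (i < N)%N -> (l < N)%N ->
     (i + l)%N = n -> `|a i| * `|b l| <= v i l) ->
  (forall i l, 0 <= v i l) ->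
  `|cross N n a b| <= \sum_(1 <= i < N) \sum_(1 <= l < N) v i l.
Proof.
move=> h v0; apply: le_trans (cross_norm HA N n a b) _.
rewrite big_nat_cond [leRHS]big_nat_cond; apply: ler_sum => i /andP[/andP[i1 i2] _].
rewrite big_nat_cond [leRHS]big_nat_cond; apply: ler_sum => l /andP[/andP[l1 l2] _].
by case: eqP => // e; exact: h.
Qed.

Hypothesis ST : S <= T.

(** Continuity of a new top level is automatic: moving an end point changes it by
the top level of a short interval plus products with a short factor. *)
Lemma top_continuous w al n Z (Y : simplex S T -> tpow A n) :
  control w -> 0 < al ->
  (forall i, (1 <= i < n)%N -> decays w al (fun x => Z x i)) ->
  decays w al Y ->
  (forall x y z, chained x y z -> Y z = Y x + Y y + cross n n (Z x) (Z y)) ->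
  continuous Y.
Proof.
move=> cw al0 dZ [C C0 hY] YD; have [M M0 hM] := control_bounded ST cw.
have w0 : forall x, 0 <= w x by case: cw.
have [|C' C'0 hZ] := @decays_uniform w (fun=> al) n.-1 Z w0.
  by move=> i hi; apply: dZ; lia.
have hZM i x : (1 <= i <= n.-1)%N -> `|Z x i| <= C' * M `^ al.
  move=> hi; apply: le_trans (hZ i x hi) _.
  by rewrite ler_wpM2l// ge0_ler_powR ?nnegrE// ltW.
pose K := \sum_(1 <= i < n) \sum_(1 <= l < n) (C' * M `^ al * C').
have K0 : 0 <= K.
  by rewrite /K; do 2 apply: sumr_ge0 => ? _; rewrite !mulr_ge0 ?powR_ge0.
have midK (v : R) x y : 0 <= v -> (forall i l, (1 <= i <= n.-1)%N -> (1 <= l <= n.-1)%N ->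
    `|Z x i| * `|Z y l| <= C' * M `^ al * C' * v) ->
    `|cross n n (Z x) (Z y)| <= K * v.
  move=> v0 hv; apply: le_trans (cross_norm_le (v := fun _ _ => C' * M `^ al * C' * v) _ _) _.
  - by move=> i l *; apply: hv; lia.
  - by move=> _ _; rewrite !mulr_ge0 ?powR_ge0.
  - by rewrite /K mulr_suml; apply: ler_sum => i _; rewrite mulr_suml.
apply: (continuous_of_increments ST cw al0 (addr_ge0 C0 K0)) => x y z h.
rewrite (YD _ _ _ h); split.
- rewrite (_ : _ - Y x = Y y + cross n n (Z x) (Z y)); last first.
    by rewrite -addrA [LHS]addrC addrA subrK addrC.
  rewrite mulrDl (le_trans (ler_normD _ _))// lerD//.
  apply: midK; rewrite ?powR_ge0// => i l hi hl.
  rewrite -[leRHS]mulrA; apply: ler_pM => //; [exact: hZM|exact: hZ].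
- rewrite (_ : _ - Y y = Y x + cross n n (Z x) (Z y)); last first.
    by rewrite addrAC addrK.
  rewrite mulrDl (le_trans (ler_normD _ _))// lerD//.
  apply: midK; rewrite ?powR_ge0// => i l hi hl.
  rewrite (_ : _ * _ * _ * _ = (C' * w x `^ al) * (C' * M `^ al)); last by ring.
  by apply: ler_pM => //; [exact: hZ|exact: hZM].
Qed.

(** The type of a level depends on its index, hence the transport along n = i. *)
Definition with_level (X : tseq A) n (v : tpow A n) : tseq A := fun i =>
  match @eqP _ n i with
  | ReflectT e => tpow_cast e v
  | ReflectF _ => X i
  end.

Lemma with_level_eq X n (v : tpow A n) x : with_level (X x) v n = v.
Proof. by rewrite /with_level; case: eqP => // e; rewrite (eq_axiomK e). Qed.

Lemma with_level_neq X n (v : tpow A n) x i :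
  n != i -> with_level (X x) v i = X x i.
Proof. by rewrite /with_level; case: eqP. Qed.

Section Extension.
Variables (j : nat) (q : R) (w : simplex S T -> R) (Z : tmap A S T).
Hypotheses (q1 : 1 <= q) (qj : q < j.+1%:R) (cw : control w).
Hypothesis Zmf : multiplicative_functional j Z.
Hypothesis Zfv : forall i, (1 <= i <= j)%N -> decays w (i%:R / q) (fun x => Z x i).

Let q0 : 0 < q. Proof. exact: lt_le_trans ltr01 q1. Qed.
Let w0 x : 0 <= w x. Proof. by case: cw. Qed.

(** Since i/q + l/q = n/q when i + l = n, every mixed product is O(w^(n/q)). *)
Lemma cross_decay : exists2 K, 0 <= K & forall x y z, chained x y z ->
  `|cross j.+1 j.+1 (Z x) (Z y)| <= K * w z `^ (j.+1%:R / q).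
Proof.
have [C C0 hC] := decays_uniform w0 Zfv.
exists (\sum_(1 <= i < j.+1) \sum_(1 <= l < j.+1) (C * C)).
  by do 2 apply: sumr_ge0 => ? _; rewrite mulr_ge0.
move=> x y z h; have [wx wy] := control_le_chained cw h.
apply: le_trans (cross_norm_le (v := fun _ _ => C * C * w z `^ (j.+1%:R / q)) _ _) _.
- move=> i l i0 l0 iN lN e.
  have -> : w z `^ (j.+1%:R / q) = w z `^ (i%:R / q) * w z `^ (l%:R / q).
    rewrite -powRD; first by rewrite -mulrDl -natrD e.
    by rewrite -mulrDl -natrD e mulf_eq0 invr_eq0 (gt_eqF q0) pnatr_eq0.
  rewrite mulrACA; apply: ler_pM => //.
    rewrite (le_trans (hC i x _)) ?i0// ler_wpM2l//.
    by rewrite ge0_ler_powR ?nnegrE// divr_ge0 ?(ltW q0).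
  rewrite (le_trans (hC l y _)) ?l0// ler_wpM2l//.
  by rewrite ge0_ler_powR ?nnegrE// divr_ge0 ?(ltW q0).
- by move=> _ _; rewrite !mulr_ge0 ?powR_ge0.
- by rewrite mulr_suml; apply: ler_sum => i _; rewrite mulr_suml.
Qed.

(** Lyons' extension theorem, with the bound in terms of the given control. *)
Lemma extension_exists : exists2 Y : tmap A S T, is_extension j Z Y &
  decays w (j.+1%:R / q) (fun x => Y x j.+1).
Proof.
set n := j.+1; set th := n%:R / q.
have th1 : 1 < th by rewrite ltr_pdivlMr// mul1r.
have [K K0 hK] := cross_decay.
pose g s t := cross n n (Z (retract ST S s)) (Z (retract ST s t)).
have gmid s u t : S <= s -> s <= u -> u <= t -> t <= T ->
    g s t - g s u - g u t = - cross n n (Z (retract ST s u)) (Z (retract ST u t)).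
  move=> Ss su ut tT; have uT := le_trans ut tT.
  have st := le_trans su ut; have Su := le_trans Ss su.
  have hm a b c i : S <= a -> a <= b -> b <= c -> c <= T -> (0 < i < n)%N ->
      Z (retract ST a c) i = Z (retract ST a b) i + Z (retract ST b c) i +
        cross n i (Z (retract ST a b)) (Z (retract ST b c)).
    move=> Sa ab bc cT.
    move=> /andP[i0 ij].
    by apply: (mf_cross Zmf (chained_retract ST Sa ab bc cT)); [rewrite i0 -ltnS | exact: ltnW].
  have e : g s t + cross n n (Z (retract ST s u)) (Z (retract ST u t)) = g s u + g u t.
    apply: (cross_cocycle HA) => i.
      exact: hm (lexx S) Ss su uT.
    exact: hm Ss su ut tT.
  by rewrite -addrA -opprD -e opprD addrA subrr add0r.
have gD s u t : S <= s -> s <= u -> u <= t -> t <= T ->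
    `|g s t - g s u - g u t| <= K * ctrl ST w s t `^ th.
  move=> Ss su ut tT; rewrite gmid// normrN.
  exact: hK (chained_retract ST Ss su ut tT).
have [G [K' [K'0 Gadd Gg]]] := sewing (ctrl_halvable ST cw) th1 K0 gD.
(* G is additive, so the defect of G - g is minus that of g: the cross terms. *)
pose y (x : simplex S T) := G (val x).1 (val x).2 - g (val x).1 (val x).2.
have yC x1 x2 x3 : chained x1 x2 x3 -> y x3 = y x1 + y x2 + cross n n (Z x1) (Z x2).
  move=> [h1 h2 h3]; have [a1 a2 _] := simplexP x1; have [_ b2 b3] := simplexP x2.
  have E1 := retract_val ST x1; have E2 := retract_val ST x2.
  rewrite /y h1 -h3 -h2; rewrite -h2 in b2 E2.
  set a := (val x1).1 in a1 a2 E1 *; set b := (val x1).2 in a2 b2 E1 E2 *.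
  set c := (val x2).2 in b2 b3 E2 *.
  have := gmid _ _ _ a1 a2 b2 b3; rewrite E1 E2 => /(congr1 -%R); rewrite opprK => <-.
  rewrite (Gadd _ _ _ a1 a2 b2 b3) !opprB !addrA.
  rewrite [RHS](ACl (1*3*7*(2*6)*(4*5)))%AC/=.
  by rewrite !addNr !addr0.
have dy : decays w th y.
  exists K' => // x; have [x1 x12 x2] := simplexP x.
  by rewrite -[w x](ctrl_val ST w) Gg.
pose Y x := with_level (Z x) (y x).
exists Y; last by apply: decays_eq dy => x; rewrite /Y with_level_eq.
have Ylow x i : (i <= j)%N -> Y x i = Z x i.
  by move=> ij; rewrite /Y with_level_neq//; rewrite /n; lia.
have Ytop x : Y x n = y x by rewrite /Y with_level_eq.
have yc : continuous y.
  have al0 : 0 < q^-1 by rewrite invr_gt0.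
  apply: (top_continuous (Z := Z) cw al0) => //.
  - move=> i /andP[i1 ij]; have := Zfv (i := i); rewrite i1 -ltnS ij => /(_ isT).
    by apply: decays_weaken => //; rewrite ler_peMl ?ler1n// ltW.
  - by apply: decays_weaken dy => //; rewrite ler_peMl ?ler1n// ltW.
have Ymf : multiplicative_functional n Y.
  apply: (mf_extend Zmf) => //.
  - move=> x i ni; rewrite /Y with_level_neq; last by lia.
    by case: Zmf => Z0 _ _ _; apply: Z0; rewrite /n in ni; lia.
  - by rewrite (_ : (fun x => Y x n) = y)//; apply: funext.
  - by move=> x1 x2 x3 h; rewrite !Ytop (yC _ _ _ h).
split=> //; exists q; split=> //; exists w => //.
- by split=> //; apply/finite_variationP.
- split=> //; apply/finite_variationP => // i /andP[i1].
  rewrite leq_eqVlt => /predU1P[->|ij].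
    by apply: decays_eq dy => x; rewrite Ytop.
  by apply: (decays_eq (f := fun x => Z x i)); [move=> x; rewrite Ylow | apply: Zfv; rewrite i1].
Qed.

End Extension.

(** The two extensions may come with different controls and exponents; both are
controlled by the sum of the controls with the smaller of the two powers. *)
Lemma extension_unique j Z Y Y' :
  is_extension j Z Y -> is_extension j Z Y' -> Y = Y'.
Proof.
move=> [Ymf YZ [q [q1 qj _ [w cw [_ Yfv]]]]] [Y'mf Y'Z [q' [q'1 q'j _ [w' cw' [_ Y'fv]]]]].
have q0 := lt_le_trans ltr01 q1; have q'0 := lt_le_trans ltr01 q'1.
set n := j.+1 in qj q'j *.
have dY : decays w (n%:R / q) (fun x => Y x n).
  by move/(finite_variationP _ _ _ q0): Yfv; apply; rewrite /= leqnn.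
have dY' : decays w' (n%:R / q') (fun x => Y' x n).
  by move/(finite_variationP _ _ _ q'0): Y'fv; apply; rewrite /= leqnn.
pose w2 x := w x + w' x; have cw2 : control w2 by exact: controlD.
have [w_ge0 w'_ge0] : (forall x, 0 <= w x) /\ (forall x, 0 <= w' x).
  by case: cw => ? h ? ?; case: cw' => ? h' ? ?.
(* Both powers exceed 1 because q, q' < n. *)
pose th := Num.min (n%:R / q) (n%:R / q').
have th1 : 1 < th by rewrite lt_min !ltr_pdivlMr// !mul1r qj.
have th0 := lt_trans ltr01 th1.
have dD : decays w2 th (fun x => Y x n - Y' x n).
  apply: decaysB.
    apply: (decays_control_le (w := w)) => //; first exact: ltW.
      by move=> x; rewrite lerDl.
    by apply: decays_weaken dY => //; rewrite ge_min lexx.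
  apply: (decays_control_le (w := w')) => //; first exact: ltW.
    by move=> x; rewrite lerDr.
  by apply: decays_weaken dY' => //; rewrite ge_min lexx orbT.
have Dadd x y z : chained x y z ->
    Y z n - Y' z n = (Y x n - Y' x n) + (Y y n - Y' y n).
  move=> h; rewrite (mf_top Ymf h) ?(mf_top Y'mf h) ?leqnn//.
  have -> : cross n n (Y' x) (Y' y) = cross n n (Y x) (Y y).
    by apply: eq_cross => // i /andP[_ hi]; rewrite YZ ?Y'Z//.
  by rewrite opprD addrACA subrr addr0 opprD addrACA.
have D0 x : Y x n = Y' x n.
  have [C C0 hC] := dD; have [h1 h2 h3] := simplexP x.
  have := @additive_small_eq0 _ _ _ _ (ctrl_halvable ST cw2) _ th C th1 C0
    (fun s t => Y (retract ST s t) n - Y' (retract ST s t) n).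
  move=> /(_ _ _ _ _ h1 h2 h3); rewrite retract_val => e.
  apply/eqP; rewrite -subr_eq0; apply/eqP; apply: e.
  - by move=> s u t *; apply: Dadd; exact: chained_retract.
  - by move=> s t *; exact: hC.
apply: funext => x; apply: functional_extensionality_dep => i.
case: (ltngtP i n) => [ij|ij|->//]; first by rewrite YZ ?Y'Z.
by case: Ymf => Y0 _ _ _; case: Y'mf => Y'0 _ _ _; rewrite Y0// Y'0.
Qed.

Lemma Ext_low j Z x i : (i <= j)%N -> Ext j Z x i = Z x i.
Proof.
by move=> ij; rewrite /Ext; case: xgetP => // Y _ [_ -> //].
Qed.

(** [Ext] is chosen independently of w and q; by uniqueness it agrees with the
extension constructed from them and inherits its bound. *)
Lemma Ext_spec j q w Z : 1 <= q -> q < j.+1%:R -> control w ->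
  multiplicative_functional j Z ->
  (forall i, (1 <= i <= j)%N -> decays w (i%:R / q) (fun x => Z x i)) ->
  multiplicative_functional j.+1 (Ext j Z) /\
  decays w (j.+1%:R / q) (fun x => Ext j Z x j.+1).
Proof.
move=> q1 qj cw Zmf Zfv; have [Y hY dY] := extension_exists q1 qj cw Zmf Zfv.
have hE : is_extension j Z (Ext j Z) := xgetI Z hY.
by rewrite (extension_unique hE hY); split=> //; case: hY.
Qed.

End Functionals.

(** * The lift and development maps *)

Section LiftDev.
Context {R : realType} {V : completeNormedModType R} {A : tensor_data V}.
Context {S T : R} (p : R).
Hypothesis HA : admissible_tensor_powers A.
Hypothesis ST : S <= T.
Hypothesis p1 : 1 <= p.
Implicit Types (X Y Z H I : tmap A S T) (w : simplex S T -> R).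

Let p0 : 0 < p. Proof. exact: lt_le_trans ltr01 p1. Qed.

Let floor_le n : (n <= Num.truncn p)%N -> n%:R <= p.
Proof. by move=> h; rewrite -truncn_ge_nat// ltW. Qed.

Lemma exponents_gt0 phi : exponents p phi -> 0 < phi.
Proof.
rewrite /exponents /= in_itv/= => /andP[h _]; apply: le_lt_trans h.
by rewrite subr_ge0 invf_le1.
Qed.

(** phi > 1 - 1/p = (p - 1)/p >= n/p. *)
Lemma exponents_level phi n : exponents p phi -> (n.+1 <= Num.truncn p)%N ->
  n%:R / p < phi.
Proof.
rewrite /exponents /= in_itv/= => /andP[h _] /floor_le np; apply: le_lt_trans h.
rewrite ler_pdivrMr// mulrBl mul1r mulVf ?gt_eqF// lerBrDr.
by rewrite -natr1 in np.
Qed.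

(** Below the level floor(p), membership in the spaces reduces to these bounds, since
phi exceeds i/p there. *)
Definition mf_decay n phi w X : Prop := multiplicative_functional n X /\
  forall i, (1 <= i <= n)%N -> decays w phi (fun x => X x i).

Lemma mf_tone k : multiplicative_functional k (fun _ : simplex S T => tone A).
Proof.
split=> //.
- by move=> x [].
- by move=> i; exact: cst_continuous.
- move=> x y z _; apply: functional_extensionality_dep => i.
  case: (leqP i k) => ik; last by rewrite /tprod leqNgt ik; case: i ik.
  case: i ik => [|i] ik.
    by rewrite tprodE// big_nat1 /= (tmul_to1l HA).
  rewrite (tprod_cross HA (ltn0Sn i) (leqnn _) ik)// !add0r.
  rewrite /cross big_nat big1// => -[|l] // _; rewrite big1// => l' _.
  by rewrite (tmul_to0l HA).
Qed.

(** The canonical extension to level m.+1; for m = 0 the extended functional is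
constantly 1, with zero first level, which lets level 1 be treated like the others. *)
Definition ext_or_one m X : tmap A S T :=
  if m is 0 then fun=> tone A else Ext m X.

(** With q = m / phi, level i <= m satisfies i/q = (i/m) phi <= phi, and the new level
has exponent ((m+1)/m) phi, which is at least phi, and at least (m+1)/p because
phi > m/p. *)
Lemma ext_or_one_spec m phi w X : exponents p phi -> control w ->
  (m.+1 <= Num.truncn p)%N -> mf_decay m phi w X ->
  [/\ multiplicative_functional m.+1 (ext_or_one m X),
      forall x i, (i <= m)%N -> ext_or_one m X x i = X x i,
      decays w phi (fun x => ext_or_one m X x m.+1) &
      decays w (m.+1%:R / p) (fun x => ext_or_one m X x m.+1)].
Proof.
move=> phiE cw mp [Xmf Xd].
case: m mp Xmf Xd => [|m] mp Xmf Xd.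
  split.
  - exact: mf_tone.
  - by move=> x [|i]//= _; case: Xmf => _ _ ->.
  - by exists 0 => // x; rewrite /= normr0 mul0r.
  - by exists 0 => // x; rewrite /= normr0 mul0r.
have phi0 := exponents_gt0 phiE; have phim := exponents_level phiE mp.
have phi1 : phi <= 1 by move: phiE; rewrite /exponents /= in_itv/= => /andP[].
set j := m.+1 in mp Xmf Xd phim *.
have j1 : 1 <= j%:R :> R by rewrite ler1n.
have j0 : 0 < j%:R :> R by rewrite ltr0n.
(* The exponent q for which level j is O(w^(j/q)) = O(w^phi). *)
pose q := j%:R / phi.
have eq_div (a : R) : a / q = a / j%:R * phi by rewrite /q invf_div mulrA mulrAC.
have q1 : 1 <= q by rewrite ler_pdivlMr// mul1r (le_trans phi1).
have qj : q < j.+1%:R.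
  rewrite ltr_pdivrMr// mulrC -ltr_pdivrMr ?ltr0n//.
  move: phiE; rewrite /exponents /= in_itv/= => /andP[+ _]; apply: le_lt_trans.
  have -> : j%:R / j.+1%:R = 1 - j.+1%:R^-1 :> R.
    by rewrite -natr1; field; rewrite natr1 pnatr_eq0.
  by rewrite lerD2l lerN2 lef_pV2 ?posrE ?ltr0n// floor_le.
have Xfv i : (1 <= i <= j)%N -> decays w (i%:R / q) (fun x => X x i).
  move=> /andP[i1 ij]; have := Xd i; rewrite i1 ij => /(_ isT).
  rewrite eq_div; apply: decays_weaken => //.
    by rewrite mulr_gt0// divr_gt0// ltr0n.
  by rewrite ler_piMl ?(ltW phi0)// ler_pdivrMr// mul1r ler_nat.
have [Emf Ed] := Ext_spec HA ST q1 qj cw Xmf Xfv.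
split=> //=.
- by move=> x i ij; rewrite Ext_low.
- apply: decays_weaken Ed => //; rewrite eq_div ler_peMl ?(ltW phi0)//.
  by rewrite ler_pdivlMr// mul1r ler_nat.
- apply: decays_weaken Ed => //; first by rewrite divr_gt0// ltr0n.
  rewrite eq_div mulrAC -mulrA ler_wpM2l// .
  by rewrite ler_pdivlMr// mulrC ltW.
Qed.

Lemma lift_mapS m I x i :
  lift_map m.+1 I x i = ext_or_one m (lift_map m I) x i + only_level m.+1 I x i.
Proof. by case: m. Qed.

Lemma devS k m H x : (m < k)%N ->
  dev k H x m.+1 = H x m.+1 - ext_or_one m (fun y => ttrunc m (H y)) x m.+1.
Proof. by move=> mk; rewrite /dev mk; case: m mk => //= _; rewrite subr0. Qed.

(** The p-variation bound in level i is implied by the phi-bound when i < floor(p),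
so only level floor(p) gives a separate condition. *)
Lemma H_phi_wP k phi w H : (k <= Num.truncn p)%N -> exponents p phi ->
  control w -> H_phi_w k p phi w H <->
  mf_decay k phi w H /\
  (k = Num.truncn p -> decays w (k%:R / p) (fun x => H x k)).
Proof.
move=> kp phiE cw; have k0 : k = Num.truncn p -> (1 <= k)%N.
  by move=> ->; rewrite truncn_gt0.
have w_ge0 : forall x, 0 <= w x by case: cw.
split.
  move=> [[Hmf /(finite_variationP _ _ _ p0) Hfv] [K K0 hK]]; split; last first.
    by move=> e; apply: Hfv; rewrite leqnn k0.
  by split=> // i hi; exists K => // x; exact: hK.
move=> [[Hmf Hd] Hk]; split; last first.
  have [K K0 hK] := decays_uniform w_ge0 Hd.
  by exists K => // x j; exact: hK.
split=> //; apply/finite_variationP => // i /andP[i1 ik].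
have [ip|] := ltnP i (Num.truncn p).
  have := Hd i; rewrite i1 ik => /(_ isT); apply: decays_weaken => //.
    by rewrite divr_gt0// ltr0n.
  by rewrite ltW// exponents_level.
move=> pi; have ek : k = Num.truncn p by lia.
have -> : i = k by lia.
exact: Hk.
Qed.

Lemma I_phi_wP k phi w I : control w -> I_phi_w k p phi w I <->
  [/\ forall x, truncated k (I x),
    forall x, I x 0%N = 0,
    forall x y z, chained x y z -> forall i, I x i + I y i = I z i,
    forall i, (1 <= i <= k)%N -> decays w phi (fun x => I x i) &
    k = Num.truncn p -> decays w (k%:R / p) (fun x => I x k)].
Proof.
move=> cw; have w_ge0 : forall x, 0 <= w x by case: cw.
split=> [[I0 I00 Iadd [K K0 hK]]|[I0 I00 Iadd Id Ik]].
  split=> //; first by move=> i hi; exists K => // x; case: (hK x) => h _; exact: h.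
  by move=> e; exists K => // x; case: (hK x) => _; exact.
split=> //; have [K K0 hK] := decays_uniform w_ge0 Id.
have [e|ne] := eqVneq k (Num.truncn p); last first.
  exists K => // x; split; first by move=> j; exact: hK.
  by move=> e; rewrite e eqxx in ne.
have [K' K'0 hK'] := Ik e; exists (Num.max K K'); first by rewrite le_max K0.
move=> x; split=> [j hj|_].
  by rewrite (le_trans (hK j x hj))// ler_wpM2r ?powR_ge0// le_max lexx.
by rewrite (le_trans (hK' x))// ler_wpM2r ?powR_ge0// le_max lexx orbT.
Qed.

Lemma only_level_eq m I x : only_level m I x m = I x m.
Proof. by rewrite /only_level eqxx. Qed.

Lemma only_level_neq m I x i : i != m -> only_level m I x i = 0.
Proof. by rewrite /only_level => /negbTE ->. Qed.

Section FixedExponent.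
Variables (k : nat) (phi : R) (w : simplex S T -> R).
Hypotheses (kp : (k <= Num.truncn p)%N) (phiE : exponents p phi) (cw : control w).

(** Level m.+1 of the lift is the canonical level plus an additive one, and both
decay with exponent phi. *)
Lemma lift_map_spec I m : I_phi_w k p phi w I -> (m <= k)%N ->
  mf_decay m phi w (lift_map m I).
Proof.
move=> /(I_phi_wP _ _ _ cw)[I0 I00 Iadd Id _]; elim: m => [|m IH] mk.
  by split; [exact: mf_tone | case].
have {}IH := IH (ltnW mk); set Z := lift_map m I in IH *.
have [Emf El Ed _] := ext_or_one_spec phiE cw (leq_trans mk kp) IH.
have Ylow x i : (i <= m)%N -> lift_map m.+1 I x i = Z x i.
  by move=> im; rewrite lift_mapS El// only_level_neq ?addr0//; lia.
have Ytop x : lift_map m.+1 I x m.+1 = ext_or_one m Z x m.+1 + I x m.+1.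
  by rewrite lift_mapS only_level_eq.
have Yd : decays w phi (fun x => lift_map m.+1 I x m.+1).
  apply: decays_eq (fun x => esym (Ytop x)) _.
  by apply: decaysD => //; apply: Id.
have Yadd x y z : chained x y z -> lift_map m.+1 I z m.+1 =
    lift_map m.+1 I x m.+1 + lift_map m.+1 I y m.+1 + cross m.+1 m.+1 (Z x) (Z y).
  move=> h; rewrite !Ytop (mf_top HA Emf h) ?leqnn// -(Iadd _ _ _ h).
  have -> : cross m.+1 m.+1 (ext_or_one m Z x) (ext_or_one m Z y) = cross m.+1 m.+1 (Z x) (Z y).
    by apply: eq_cross => // i /andP[_ hi]; rewrite El.
  by rewrite addrAC addrACA.
split; last first.
  move=> i /andP[i1]; rewrite leq_eqVlt => /predU1P[->//|im].
  case: IH => _ IHd; have := IHd i; rewrite i1 -ltnS im => /(_ isT).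
  by apply: decays_eq => x; rewrite Ylow.
case: IH => Zmf Zd; apply: (mf_extend HA Zmf) => //.
- move=> x i mi; rewrite lift_mapS only_level_neq ?addr0; last by lia.
  by case: Emf => E0 _ _ _; exact: E0.
- by apply: (top_continuous HA ST (Z := Z) cw (exponents_gt0 phiE)).
Qed.

Lemma lift_mapS_low I m x i : I_phi_w k p phi w I -> (m < k)%N ->
  (i <= m)%N -> lift_map m.+1 I x i = lift_map m I x i.
Proof.
move=> hI mk im; rewrite lift_mapS only_level_neq ?addr0; last by lia.
have [_ -> //] := ext_or_one_spec phiE cw (leq_trans mk kp) (lift_map_spec hI (ltnW mk)).
Qed.

Lemma ttrunc_lift_map I m : I_phi_w k p phi w I -> (m <= k)%N ->
  (fun x => ttrunc m (lift_map k I x)) = lift_map m I.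
Proof.
move=> hI mk; apply: funext => x; apply: functional_extensionality_dep => i.
rewrite /ttrunc; case: leqP => im; last first.
  by have [[L0 _ _ _] _] := lift_map_spec hI mk; rewrite L0.
have : (k <= k)%N by []; rewrite -[in X in (X <= _)%N -> _](subnK mk).
rewrite -[in RHS](addKn m m) -[in LHS](subnK mk); move: (k - m)%N => d.
elim: d => [|d IH] h; first by rewrite add0n addnK.
rewrite addSn lift_mapS_low//; [|by lia].
by apply: IH; lia.
Qed.

Lemma lift_map_fun I : I_phi_w k p phi w I -> H_phi_w k p phi w (lift_map k I).
Proof.
move=> hI; apply/H_phi_wP => //; have hL := lift_map_spec hI (leqnn k).
split=> // ek; have k0 : (0 < k)%N by rewrite ek truncn_gt0.
have mk : (k.-1 < k)%N by rewrite prednK.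
have [_ _ _] := ext_or_one_spec phiE cw (leq_trans mk kp) (lift_map_spec hI (ltnW mk)).
rewrite prednK// => E2; have [_ _ _ _ dI] := (I_phi_wP _ _ _ cw).1 hI.
apply: (decays_eq (f := fun x => ext_or_one k.-1 (lift_map k.-1 I) x k + I x k)).
  by move=> x; have := lift_mapS k.-1 I x k; rewrite prednK// only_level_eq.
by apply: decaysD => //; exact: dI.
Qed.

(** H and the canonical extension of its truncation have the same lower levels, so
their difference in the next level is additive. *)
Lemma dev_fun H : H_phi_w k p phi w H -> I_phi_w k p phi w (dev k H).
Proof.
move=> /(H_phi_wP _ kp phiE cw)[[Hmf Hd] Hk]; apply/I_phi_wP => //.
have St m : (m < k)%N -> [/\
      multiplicative_functional m.+1 (ext_or_one m (fun y => ttrunc m (H y))),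
      forall x i, (i <= m)%N -> ext_or_one m (fun y => ttrunc m (H y)) x i = H x i,
      decays w phi (fun x => ext_or_one m (fun y => ttrunc m (H y)) x m.+1) &
      decays w (m.+1%:R / p) (fun x => ext_or_one m (fun y => ttrunc m (H y)) x m.+1)].
  move=> mk; have hT : mf_decay m phi w (fun y => ttrunc m (H y)).
    split; first by apply: mf_ttrunc Hmf _; exact: ltnW.
    move=> i /andP[i1 im]; have := Hd i; rewrite i1 (leq_trans im (ltnW mk)) => /(_ isT).
    by apply: decays_eq => x; rewrite /ttrunc im.
  have [Emf El E1 E2] := ext_or_one_spec phiE cw (leq_trans mk kp) hT; split=> //.
  by move=> x i im; rewrite El// /ttrunc im.
split.
- by move=> x i ki; rewrite /dev leqNgt ki.
- by [].
- move=> x y z h [|m]; first by rewrite /dev /= addr0.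
  have [mk|mk] := ltnP m k; last by rewrite /dev leqNgt ltnS mk /= addr0.
  have [Emf El _ _] := St _ mk.
  rewrite !devS// (mf_top HA Emf h) ?leqnn// (mf_cross HA Hmf h (n := m.+1))//.
  have -> : cross m.+1 m.+1 (ext_or_one m (fun y => ttrunc m (H y)) x)
      (ext_or_one m (fun y => ttrunc m (H y)) y) = cross m.+1 m.+1 (H x) (H y).
    by apply: eq_cross => // i /andP[_ hi]; rewrite El.
  by symmetry; rewrite opprD addrACA subrr addr0 opprD addrACA.
- move=> [//|m] mk; have [_ _ E1 _] := St _ mk.
  apply: (decays_eq (f := fun x => H x m.+1 - ext_or_one m (fun y => ttrunc m (H y)) x m.+1)).
    by move=> x; rewrite devS.
  by apply: decaysB => //; apply: Hd.
- move=> ek; have k0 : (0 < k)%N by rewrite ek truncn_gt0.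
  have mk : (k.-1 < k)%N by rewrite prednK.
  have [_ _ _] := St _ mk; rewrite prednK// => E2.
  apply: (decays_eq (f := fun x => H x k - ext_or_one k.-1 (fun y => ttrunc k.-1 (H y)) x k)).
    move=> x. have := devS H x mk; by rewrite prednK.
  by apply: decaysB => //; apply: Hk.
Qed.

(** The truncation of the lift at level m is the lift of the truncation, so dev
subtracts exactly the canonical level that the lift had added. *)
Lemma dev_lift_map I : I_phi_w k p phi w I -> dev k (lift_map k I) = I.
Proof.
move=> hI; have [I0 I00 _ _ _] := (I_phi_wP _ _ _ cw).1 hI.
apply: funext => x; apply: functional_extensionality_dep => -[|m].
  by rewrite /dev /= I00.
have [mk|mk] := ltnP m k; last by rewrite /dev leqNgt ltnS mk /= I0.
rewrite devS// ttrunc_lift_map ?(ltnW mk)//.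
have -> : lift_map k I x m.+1 = lift_map m.+1 I x m.+1.
  by rewrite -(ttrunc_lift_map hI mk) /ttrunc leqnn.
by rewrite lift_mapS only_level_eq addrC addrA addNr add0r.
Qed.

(** By induction on m, the lift of the first m levels of dev k H is the truncation of
H: the canonical level that dev subtracts is the one that the lift adds back. *)
Lemma lift_map_dev H : H_phi_w k p phi w H -> lift_map k (dev k H) = H.
Proof.
move=> hH; have [[[H0 _ H1 _] _] _] := (H_phi_wP _ kp phiE cw).1 hH.
have tr m : (m <= k)%N -> lift_map m (dev k H) = fun x => ttrunc m (H x).
  elim: m => [|m IH] mk.
    apply: funext => x; apply: functional_extensionality_dep => -[|i].
      by rewrite /ttrunc /= H1.
    by rewrite /ttrunc.
  apply: funext => x; apply: functional_extensionality_dep => i.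
  have hL := lift_map_spec (dev_fun hH) (ltnW mk).
  have [Emf El _ _] := ext_or_one_spec phiE cw (leq_trans mk kp) hL.
  rewrite lift_mapS; case: (ltngtP i m.+1) => [im|im|->].
  - rewrite El// IH ?(ltnW mk)// only_level_neq ?addr0; last by lia.
    by rewrite /ttrunc -ltnS im ltnW.
  - rewrite only_level_neq ?addr0; last by lia.
    by case: Emf => E0 _ _ _; rewrite E0// /ttrunc leqNgt im.
  - by rewrite only_level_eq devS// IH ?(ltnW mk)// addrC subrK /ttrunc leqnn.
rewrite tr//; apply: funext => x; apply: functional_extensionality_dep => i.
by rewrite /ttrunc; case: leqP => // ki; rewrite H0.
Qed.

End FixedExponent.
End LiftDev.

Lemma bij_with_inverse_intro (E F : Type) (B : set E) (C : set F)
    (f : E -> F) (g : F -> E) :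
  (forall x, B x -> C (f x) /\ g (f x) = x) ->
  (forall y, C y -> B (g y) /\ f (g y) = y) -> bij_with_inverse B C f g.
Proof.
move=> hf hg; split.
- split.
  + by move=> x /hf[].
  + move=> x y /set_mem/hf[_ fx] /set_mem/hf[_ fy] e.
    by rewrite -fx -fy e.
  + by move=> y /hg[Bg e]; exists (g y).
- by move=> y /hg[].
- by move=> x /set_mem/hf[].
- by move=> y /set_mem/hg[].
Qed.

Theorem corollary3p22 (R : realType) (S T : R) (V : completeNormedModType R)
    (A : tensor_data V) (p : R) (k : nat) :
  S <= T -> admissible_tensor_powers A -> 1 <= p -> (k <= Num.truncn p)%N ->
  bij_with_inverse (@I_all R V A S T k p) (H_all k p) (lift_map k) (dev k) /\
  (forall (w : simplex S T -> R) (phi : R), control w -> exponents p phi ->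
    [/\ bij_with_inverse (@I_phi_w R V A S T k p phi w) (H_phi_w k p phi w)
          (lift_map k) (dev k),
        bij_with_inverse (@I_phi R V A S T k p phi) (H_phi k p phi)
          (lift_map k) (dev k) &
        bij_with_inverse (@I_w R V A S T k p w) (H_w k p w)
          (lift_map k) (dev k)]).
Proof.
move=> ST HA p1 kp.
have lift_dev phi w : exponents p phi -> control w -> forall I : tmap A S T,
    I_phi_w k p phi w I ->
    H_phi_w k p phi w (lift_map k I) /\ dev k (lift_map k I) = I.
  by move=> hphi cw I hI; split; [apply: lift_map_fun|apply: (dev_lift_map (p := p))]; eauto.
have dev_lift phi w : exponents p phi -> control w -> forall H : tmap A S T,
    H_phi_w k p phi w H ->
    I_phi_w k p phi w (dev k H) /\ lift_map k (dev k H) = H.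
  by move=> hphi cw H hH; split; [apply: dev_fun|apply: (lift_map_dev (p := p))]; eauto.
split; last move=> w phi cw hphi; last split; apply: bij_with_inverse_intro.
- move=> I [phi hphi [w cw /(lift_dev _ _ hphi cw)[? ?]]].
  by split=> //; exists phi => //; exists w.
- move=> H [phi hphi [w cw /(dev_lift _ _ hphi cw)[? ?]]].
  by split=> //; exists phi => //; exists w.
- exact: lift_dev.
- exact: dev_lift.
- by move=> I [v cv /(lift_dev _ _ hphi cv)[? ?]]; split=> //; exists v.
- by move=> H [v cv /(dev_lift _ _ hphi cv)[? ?]]; split=> //; exists v.
- by move=> I [psi hpsi /(lift_dev _ _ hpsi cw)[? ?]]; split=> //; exists psi.
- by move=> H [psi hpsi /(dev_lift _ _ hpsi cw)[? ?]]; split=> //; exists psi.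
Qed.
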